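(* Let $K\in\mathbb R$ and let $(X,\mathsf d,\mathfrak m)$ be an $RCD(K,\infty)$ space such that $\mathrm{supp}(\mathfrak m)=X$. Let $\widetilde{\mathsf d}_t,\mathsf d_t$ ($t\ge0$) be the functions on $X\times X$ defined in the context. (1) $\widetilde{\mathsf d}_0=\mathsf d_0=\mathsf d$, and for every $t>0$ the functions $\widetilde{\mathsf d}_t$ and $\mathsf d_t$ are (finite, real valued) pseudo-distances on $X$, i.e. they share all the properties of a distance except that they may be $0$ at couples of different points. (2) If for some $t>0$ the map $\mathsf H_t:\mathscr P_2(X)\to\mathscr P_2(X)$ is injective, then $\widetilde{\mathsf d}_t$ and $\mathsf d_t$ are distances. (3) If moreover (in addition to the injectivity of $\mathsf H_t$ for that $t$) $(X,\mathsf d)$ is compact, then the distances $\widetilde{\mathsf d}_t$ and $\mathsf d_t$ induce on $X$ the same topology as $\mathsf d$.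
   Context: Spaces and $W_2$. $(X,\mathsf d)$ is a complete separable metric space with a non-negative Radon measure $\mathfrak m$ such that $\int_X e^{-C\mathsf d^2(\cdot,x_0)}\,\mathrm d\mathfrak m<+\infty$ for some $C>0$, $x_0\in X$. $\mathscr P_2(X)$ is the set of Borel probability measures with finite second moment, with the quadratic Kantorovich distance $W_2$ (cost $\mathsf d^2$). Cheeger energy. $\mathrm{Ch}(f):=\inf\varliminf_n\frac12\int_X|Df_n|^2\,\mathrm d\mathfrak m$ for $f\in L^2(X,\mathfrak m)$, the infimum being over sequences of Lipschitz functions $f_n\in L^2(X,\mathfrak m)$ converging to $f$ in $L^2$, where $|Dh|(x):=\varlimsup_{y\to x}\frac{|h(y)-h(x)|}{\mathsf d(x,y)}$. $W^{1,2}(X,\mathsf d,\mathfrak m):=\{f\in L^2:\mathrm{Ch}(f)<\infty\}$ with norm $\|f\|_{W^{1,2}}^2=\|f\|_{L^2}^2+2\mathrm{Ch}(f)$. Entropy. $\mathrm{Ent}_{\mathfrak m}:\mathscr P_2(X)\to\mathbb R\cup\{+\infty\}$, $\mathrm{Ent}_{\mathfrak m}(\rho\mathfrak m)=\int\rho\log\rho\,\mathrm d\mathfrak m$, and $+\infty$ on measures not absolutely continuous w.r.t. $\mathfrak m$; $D(\mathrm{Ent}_{\mathfrak m})$ is the set where it is finite. The space is $CD(K,\infty)$ if for all $\mu,\nu\in D(\mathrm{Ent}_{\mathfrak m})$ there is a $W_2$-geodesic $(\mu_t)_{t\in[0,1]}$ from $\mu$ to $\nu$ with $\mathrm{Ent}_{\mathfrak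 m}(\mu_t)\le(1-t)\mathrm{Ent}_{\mathfrak m}(\mu)+t\,\mathrm{Ent}_{\mathfrak m}(\nu)-\frac K2t(1-t)W_2^2(\mu,\nu)$ for all $t$. It is $RCD(K,\infty)$ if it is $CD(K,\infty)$ and $W^{1,2}(X,\mathsf d,\mathfrak m)$ is a Hilbert space. Heat flow. On a $CD(K,\infty)$ space, for $\mu\in D(\mathrm{Ent}_{\mathfrak m})$ the gradient flow of the entropy from $\mu$ is the unique locally absolutely continuous curve $(\mu_t)_{t\ge0}$ in $(\mathscr P_2(X),W_2)$ with $\mu_0=\mu$ and $\mathrm{Ent}_{\mathfrak m}(\mu)=\mathrm{Ent}_{\mathfrak m}(\mu_T)+\frac12\int_0^T|\dot\mu_t|^2\mathrm dt+\frac12\int_0^T|D^-\mathrm{Ent}_{\mathfrak m}|^2(\mu_t)\,\mathrm dt$ for all $T>0$, where $|D^-\mathrm{Ent}_{\mathfrak m}|(\nu)=\varlimsup_{\sigma\to\nu}\frac{(\mathrm{Ent}_{\mathfrak m}(\sigma)-\mathrm{Ent}_{\mathfrak m}(\nu))^-}{W_2(\sigma,\nu)}$. On an $RCD(K,\infty)$ space, $\mathsf H_t:\mathscr P_2(\mathrm{supp}(\mathfrak m))\to\mathscr P_2(\mathrm{supp}(\mathfrak m))$, $t\ge0$, denotes the unique family of maps such that (known facts) $W_2(\mathsf H_t(\mu),\mathsf H_t(\nu))\le e^{-Kt}W_2(\mu,\nu)$, $t\mapsto\mathsf H_t(\mu)$ is $W_2$-continuous, and for $\mu\in D(\mathrm{Ent}_{\mathfrak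 m})$ the curve $t\mapsto\mathsf H_t(\mu)$ is the gradient flow of the entropy from $\mu$. The flow. When $\mathrm{supp}(\mathfrak m)=X$ and $t\ge0$: $\widetilde{\mathsf d}_t(x,y):=W_2(\mathsf H_t(\delta_x),\mathsf H_t(\delta_y))$; for a $\widetilde{\mathsf d}_t$-Lipschitz curve $\gamma$, $|\dot\gamma_s|_t:=\lim_{h\to0}\widetilde{\mathsf d}_t(\gamma_{s+h},\gamma_s)/|h|$ (exists for a.e. $s$); and $\mathsf d_t(x,y):=\inf_\gamma\int_0^1|\dot\gamma_s|_t\,\mathrm ds$, the infimum over all $\mathsf d$-Lipschitz curves $\gamma:[0,1]\to X$ joining $x$ to $y$ (these are $\widetilde{\mathsf d}_t$-Lipschitz by the contraction estimate). *)

(* Defs.v *)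
From HB Require Import structures.
From mathcomp Require Import all_boot all_order all_algebra.
From mathcomp Require Import all_classical all_reals all_analysis.
From mathcomp Require Import giry.

Set Implicit Arguments.
Unset Strict Implicit.
Unset Printing Implicit Defensive.

Import Order.TTheory GRing.Theory Num.Theory.
Import numFieldNormedType.Exports.

Local Open Scope classical_set_scope.
Local Open Scope ring_scope.

(* [Complete] extends pointed types, so these spaces are nonempty. *)
#[short(type="completeMetricType")]
HB.structure Definition CompleteMetric (R : numDomainType) :=
  {T of Complete T & Metric R T}.

Notation borel X := (g_sigma_algebraType (@open X)).

Section ExtendedDistances.
Context {R : realType} {X : Type}.
Implicit Type D : X -> X -> \bar R.
Local Open Scope ereal_scope.

Definition pseudo_distance D :=
  [/\ forall x y, D x y \is a fin_num /\ 0 <= D x y,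
      forall x, D x x = 0,
      forall x y, D x y = D y x &
      forall x y z, D x z <= D x y + D y z].

Definition distance D :=
  pseudo_distance D /\ forall x y, D x y = 0 -> x = y.

Definition distance_open D (U : set X) :=
  forall x, U x -> exists2 r : R, (0 < r)%R & [set y | D x y < r%:E] `<=` U.

(* The limit is taken in [\bar R]; where it does not exist, [lim] returns an
   unspecified value. This happens only on a null set for the curves of
   interest. *)
Definition metric_speed D (c : R -> X) (s : R) : \bar R :=
  lim ((D (c (s + h)%R) (c s) * (`|h|^-1)%:E) @[h --> (0%R : R)^']).

(* Absolute continuity on every bounded interval [0, T]. *)
Definition locally_abs_continuous D (c : R -> X) :=
  forall T : R, (0 < T)%R -> exists2 g : R -> R,
    lebesgue_measure.-integrable `[0%R, T] (EFin \o g) &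
    forall s t : R, (0 <= s)%R -> (s <= t)%R -> (t <= T)%R ->
      D (c s) (c t) <= \int[lebesgue_measure]_(r in `[s, t]) (g r)%:E.

End ExtendedDistances.

Section MetricMeasureSpaces.
Context {R : realType} {X : completeMetricType R}.
Implicit Types (m : {measure set (borel X) -> \bar R}).
Implicit Types (mu nu : probability (borel X) R).
Local Open Scope ereal_scope.

Definition lipschitz_fun (f : X -> R) :=
  exists L : R, forall x y, (`|f x - f y| <= L * mdist x y)%R.

Definition lipschitz_curve (c : R -> X) :=
  exists L : R, forall s t, s \in `[0%R, 1%R] -> t \in `[0%R, 1%R] ->
    (mdist (c s) (c t) <= L * `|s - t|)%R.

Definition separable_space := exists2 S : set X, countable S & dense S.

Definition msupport m : set X :=
  [set x | forall U : set X, open U -> U x -> 0 < m U].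

Definition radon m :=
  (forall C : set X, compact C -> m C < +oo) /\
  (forall A : set (borel X), measurable A ->
    m A = ereal_sup [set m C | C in [set C : set X | compact C /\ C `<=` A]]).

Definition gaussian_integrable m :=
  exists (C : R) (x0 : X), (0 < C)%R /\
    \int[m]_x (expR (- C * mdist (x : X) x0 ^+ 2))%:E < +oo.

Definition metric_measure_space m :=
  [/\ separable_space, radon m & gaussian_integrable m].

Definition P2 : set (probability (borel X) R) :=
  [set mu : probability (borel X) R | exists x0 : X, \int[mu]_x (mdist (x : X) x0 ^+ 2)%:E < +oo].

Definition coupling mu nu : set (probability (borel X * borel X)%type R) :=
  [set pi : probability (borel X * borel X)%type R | forall A : set (borel X), measurable A ->
    pi (fst @^-1` A) = mu A /\ pi (snd @^-1` A) = nu A].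

Definition W2 mu nu : \bar R :=
  sqrte (ereal_inf
    [set \int[pi]_z (mdist (z.1 : X) (z.2 : X) ^+ 2)%:E | pi in coupling mu nu]).

(* Constant speed geodesics of P2, with values relevant on [0, 1] only.
   Measures are compared with [measure_eq], as a measure also carries
   irrelevant values on the sets that are not measurable. *)
Definition W2_geodesic mu nu (c : R -> probability (borel X) R) :=
  [/\ forall t, t \in `[0%R, 1%R] -> P2 (c t),
      measure_eq (c 0%R) mu, measure_eq (c 1%R) nu &
      forall s t, s \in `[0%R, 1%R] -> t \in `[0%R, 1%R] ->
        W2 (c s) (c t) = `|s - t|%:E * W2 mu nu].

(* |Dh|(x), with the usual value 0 at isolated points, where the limsup over
   the punctured neighbourhoods is the supremum -oo of the empty set. *)
Definition slope (h : X -> R) (x : X) : \bar R :=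
  maxe 0 (limf_esup (fun y => (`|h y - h x| / mdist x y)%:E) x^').

Definition Cheeger m (f : X -> R) : \bar R :=
  ereal_inf
    [set limn_einf (fun n => (2^-1)%:E * \int[m]_x (slope (g n) x ^+ 2))
    | g in [set g : nat -> X -> R |
        (forall n, lipschitz_fun (g n) /\ (g n : borel X -> R) \in Lfun m 2%:E) /\
        'N[m]_2%:E[EFin \o (g n \- f)%R] @[n --> \oo] --> 0]].

Definition W12 m : set (X -> R) :=
  [set f | (f : borel X -> R) \in Lfun m 2%:E /\ Cheeger m f < +oo].

Definition W12_norm m (f : X -> R) : \bar R :=
  sqrte ('N[m]_2%:E[EFin \o f] ^+ 2 + 2%:E * Cheeger m f).

(* The elements of W12 are functions rather than their classes modulo
   m-a.e. equality: the norm vanishes exactly on the class of 0, and so the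
   inner product is definite on classes. *)
Definition W12_hilbert m :=
  (exists B : (X -> R) -> (X -> R) -> R,
    [/\ forall f g, W12 m f -> W12 m g -> B f g = B g f,
        forall (a : R) f g h, W12 m f -> W12 m g -> W12 m h ->
          B (fun x => a * f x + g x)%R h = (a * B f h + B g h)%R &
        forall f, W12 m f -> (B f f)%:E = W12_norm m f ^+ 2]) /\
  (forall u : nat -> X -> R, (forall n, W12 m (u n)) ->
    (forall e : R, (0 < e)%R -> exists N : nat, forall n k : nat,
      (N <= n)%N -> (N <= k)%N -> W12_norm m (u n \- u k)%R < e%:E) ->
    exists2 f, W12 m f & W12_norm m (u n \- f)%R @[n --> \oo] --> 0).

Definition density m mu (rho : borel X -> R) :=
  [/\ measurable_fun setT rho, forall x, (0 <= rho x)%R &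
      forall A, measurable A -> mu A = \int[m]_(x in A) (rho x)%:E].

(* Densities are unique up to m-null sets: this is the infimum of a singleton
   if mu has a density, and +oo otherwise. *)
Definition Ent m mu : \bar R :=
  ereal_inf [set \int[m]_x (rho x * ln (rho x))%:E | rho in density m mu].

Definition Ent_dom m : set (probability (borel X) R) :=
  [set mu : probability (borel X) R | P2 mu /\ Ent m mu \is a fin_num].

(* |D^-Ent|, a limsup as sigma tends to nu in (P2, W2), sigma <> nu. *)
Definition Ent_slope m nu : \bar R :=
  maxe 0 (ereal_inf
    [set ereal_sup
      [set maxe 0 (- (Ent m sigma - Ent m nu)) * ((fine (W2 sigma nu))^-1)%:E
      | sigma in [set sigma | P2 sigma /\ 0 < W2 sigma nu < r%:E]]
    | r in [set r : R | (0 < r)%R]]).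

Definition CD (K : R) m :=
  forall mu nu, Ent_dom m mu -> Ent_dom m nu ->
    exists2 c, W2_geodesic mu nu c &
      forall t : R, t \in `[0%R, 1%R] ->
        Ent m (c t) <= (1 - t)%:E * Ent m mu + t%:E * Ent m nu
          - (K / 2 * t * (1 - t))%:E * W2 mu nu ^+ 2.

Definition RCD (K : R) m :=
  [/\ metric_measure_space m, CD K m & W12_hilbert m].

Definition Ent_gradient_flow m mu (c : R -> probability (borel X) R) :=
  [/\ forall t : R, (0 <= t)%R -> P2 (c t),
      locally_abs_continuous W2 c,
      measure_eq (c 0%R) mu &
      forall T : R, (0 < T)%R ->
        Ent m mu = Ent m (c T)
          + (2^-1)%:E * \int[lebesgue_measure]_(t in `[0%R, T])
              (metric_speed W2 c t ^+ 2)
          + (2^-1)%:E * \int[lebesgue_measure]_(t in `[0%R, T])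
              (Ent_slope m (c t) ^+ 2)].

(* The characteristic properties of the heat flow when the support is X. *)
Definition heat_flow (K : R) m
    (H : R -> probability (borel X) R -> probability (borel X) R) :=
  [/\ forall (t : R) mu, (0 <= t)%R -> P2 mu -> P2 (H t mu),
      forall (t : R) mu nu, (0 <= t)%R -> P2 mu -> P2 nu ->
        W2 (H t mu) (H t nu) <= (expR (- K * t))%:E * W2 mu nu,
      forall (t : R) mu, (0 <= t)%R -> P2 mu ->
        W2 (H s mu) (H t mu) @[s --> within [set s | 0 <= s]%R (nbhs t)] --> 0 &
      forall mu, Ent_dom m mu -> Ent_gradient_flow m mu (H ^~ mu)].

Definition injective_on_P2
    (F : probability (borel X) R -> probability (borel X) R) :=
  forall mu nu, P2 mu -> P2 nu -> measure_eq (F mu) (F nu) -> measure_eq mu nu.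

Definition delta (x : X) : probability (borel X) R := @dirac _ (borel X) x R.

Definition dtilde (H : R -> probability (borel X) R -> probability (borel X) R)
    (t : R) (x y : X) : \bar R :=
  W2 (H t (delta x)) (H t (delta y)).

Definition dflow (H : R -> probability (borel X) R -> probability (borel X) R)
    (t : R) (x y : X) : \bar R :=
  ereal_inf
    [set \int[lebesgue_measure]_(s in `[0%R, 1%R])
           metric_speed (dtilde H t) c s
    | c in [set c : R -> X | [/\ lipschitz_curve c, c 0%R = x & c 1%R = y]]].

Definition same_topology (D : X -> X -> \bar R) :=
  forall U : set X, distance_open D U <-> open U.

End MetricMeasureSpaces.

(* Main.v *)
Require Import Defs.
From HB Require Import structures.
From mathcomp Require Import all_boot all_order all_algebra.
From mathcomp Require Import all_classical all_reals all_analysis.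
From mathcomp Require Import measurable_realfun giry.
From mathcomp Require Import ring lra.

Set Implicit Arguments.
Unset Strict Implicit.
Unset Printing Implicit Defensive.

Import Order.TTheory GRing.Theory Num.Theory.
Import numFieldNormedType.Exports.

Local Open Scope classical_set_scope.
Local Open Scope ring_scope.


(** The functions dtilde and dflow are compared with the distance d, W2 and each
    other; everything rests on four facts.

    W2 is a distance between probabilities on a separable space. For the
    triangle inequality ([W2_triangle]) two plans are glued along a countable
    partition of the middle space into pieces of diameter at most e
    ([approximate_gluing]), which costs e and avoids disintegration. If W2
    vanishes the measures agree ([W2_eq0]). Between Dirac masses W2 is d
    ([W2_delta]). Hence dtilde is a pseudo-distance with
    dtilde H t x y <= exp (- K t) d x y, and a distance if H t is injective.

    H 0 fixes Dirac masses. The uniform measure on a small ball has finite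
    entropy and is W2-close to the Dirac mass at the centre
    ([ball_probability]); it is fixed by H 0, being the initial point of its own
    gradient flow, and H 0 is a contraction ([heat_flow0_delta]).

    X is a length space. The W2-midpoint that CD provides between two such
    uniform measures nearly minimizes, for the centres x and y, the integral of
    the sum of the squared distances to x and to y, and so gives weight to
    approximate midpoints of x and y ([CD_midpoint]). Completeness then yields
    Lipschitz curves from x to y of constant d x y + e
    ([almost_shortest_curve]), whence
    dflow H t x y <= exp (- K t) d x y ([intrinsic_le]).

    The length of a Lipschitz curve c is the increment over [0, 1] of some
    Lipschitz function M with D (c s) (c t) <= M t - M s ([length_primitive]),
    and it is at most that of any such function ([length_le]). This follows from
    the almost everywhere existence of the metric speed
    ([metric_speed_density]), hence from the differentiability of Lipschitz
    functions and from the fact that they are the integrals of their derivatives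
    ([lipschitz_density]), itself a consequence of the theorems of Radon-Nikodym
    and Lebesgue. The first property gives dtilde <= dflow, and the second,
    applied to reversed and concatenated functions, the symmetry of dflow and
    its triangle inequality, without any change of variables.

    On a compact space, y |-> dtilde H t x y is continuous and positive away
    from x, so every neighbourhood of x contains a dtilde-ball around x. As
    dtilde <= dflow <= exp (- K t) d, all three have the same topology
    ([compact_same_topology]). *)

(** * Lipschitz functions are integrals of their derivatives *)

#[local] Instance lebesgue_ae_filter (R : realType) :
  Filter (almost_everywhere (@lebesgue_measure R)).
Proof. exact: (ae_filter_ringOfSetsType lebesgue_measure). Qed.

Section lipschitz_stieltjes.
Context {R : realType} (f : R -> R) (L : R).
Hypothesis fL : forall s t, `|f s - f t| <= L * `|s - t|.

(** A Lipschitz function made nondecreasing by the addition of a linear one,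
    so as to be the cumulative function of a Stieltjes measure. *)
Definition tilt (x : R) : R := f x + L * x.

Let tilt_nd : {homo tilt : x y / x <= y}.
Proof.
move=> x y xy; rewrite /tilt; have := fL x y. rewrite ler_distl => /andP[_].
rewrite distrC ger0_norm ?subr_ge0// mulrBr. lra.
Qed.

Let tilt_le x y : x <= y -> tilt y - tilt x <= (2 * L) * (y - x).
Proof.
move=> xy; rewrite /tilt; have := fL y x.
rewrite ler_distl => /andP[_].
rewrite ger0_norm ?subr_ge0// !mulrBr. lra.
Qed.

Let tilt_continuous : continuous tilt.
Proof.
move=> x; rewrite /tilt; apply: cvgD; last by apply: cvgZr; exact: cvg_id.
apply/cvgrPdist_le => e e0; have [L0|L0] := leP L 0.
  by near=> t; rewrite (le_trans (fL _ _))// (le_trans _ (ltW e0))// mulr_le0_ge0.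
near=> t; rewrite (le_trans (fL _ _))//.
rewrite mulrC -ler_pdivlMr//.
near: t; apply: cvgr_dist_le; first exact: cvg_id.
by rewrite divr_gt0.
Unshelve. all: by end_near. Qed.

Let tilt_rc : right_continuous tilt.
Proof.
apply: right_continuousW; exact: tilt_continuous.
Qed.

HB.instance Definition _ := isCumulative.Build R _ R tilt tilt_nd tilt_rc.

Let nu := lebesgue_stieltjes_measure tilt.
Let la := @lebesgue_measure R.

Lemma tilt_measure_itv a b : a <= b -> nu `]a, b] = (tilt b - tilt a)%:E.
Proof.
move=> ab. rewrite /nu /lebesgue_stieltjes_measure /measure_extension.
rewrite measurable_mu_extE/=; last exact: is_ocitv.
by rewrite wlength_itv_bnd.
Qed.

(** The Stieltjes measure is at most 2L times the Lebesgue measure: both are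
    infima over covers by intervals. *)
Lemma tilt_measure_le (A : set R) : 0 < L -> 
  ((2 * L)^-1%:E * nu A <= la A)%E.
Proof.
move=> L0. apply: le_ereal_inf_tmp => _ [C cC <-].
have h : (nu A <= \sum_(0 <= k <oo) wlength tilt (C k))%E.
  by apply: ereal_inf_lbound; exists C.
apply: (@le_trans _ _ ((2 * L)^-1%:E * \sum_(0 <= k <oo) wlength tilt (C k))%E).
  by apply: lee_wpmul2l => //; rewrite lee_fin invr_ge0 mulr_ge0// ltW.
rewrite -nneseriesZl//.
apply: lee_nneseries.
  move=> i _ _; apply: mule_ge0; last exact: wlength_ge0.
  by rewrite lee_fin invr_ge0 mulr_ge0// ltW.
move=> i _.
have [mC _] := cC; have := mC i => -[[a b] _ <-].
have [ab|ba] := leP a b; last first.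
  by rewrite set_itv_ge ?bnd_simp -?leNgt ?(ltW ba)// !wlength0 mule0.
rewrite (wlength_itv_bnd tilt _ _ ab) [leRHS](wlength_itv_bnd _ _ _ ab) -EFinM lee_fin mulrC ler_pdivrMr ?mulr_gt0//.
by rewrite mulrC tilt_le.
Qed.


(** Radon-Nikodym, applied to the restriction to the unit interval. *)
Lemma tilt_measure_density : 0 < L -> exists g : R -> R,
  [/\ measurable_fun setT g, (forall x, 0 <= g x),
    la.-integrable setT (EFin \o g) &
    forall s t, 0 <= s -> s <= t -> t <= 1 ->
    (tilt t - tilt s)%:E = (\int[la]_(x in `]s, t]) (g x)%:E)%E].
Proof.
move=> L0.
have I01 : measurable (`]0, 1]%classic : set (measurableTypeR R)) by exact: measurable_itv.
have fin01 : (nu `]0%R, 1%R] < +oo)%E by rewrite tilt_measure_itv// ltry.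
pose nu1 := mfrestr I01 fin01.
have dom : nu1 `<< la.
  apply/null_content_dominatesP => A mA A0.
  have : ((2 * L)^-1%:E * nu A <= 0)%E by rewrite -A0 tilt_measure_le.
  rewrite /nu1 /mfrestr /mrestr => h.
  have : (nu A <= 0)%E.
    rewrite -(@lee_pmul2l _ (2 * L)^-1%:E) ?mule0// ?fin_numE// lte_fin invr_gt0.
    by rewrite mulr_gt0.
  move=> nuA; apply/eqP; rewrite eq_le measure_ge0 andbT (le_trans _ nuA)//.
  by apply: le_measure; rewrite ?inE//; exact: measurableI.
have [g [g0 gfin gint gE]] := @radon_nikodym_sigma_finite _ (measurableTypeR R) R la nu1 dom.
exists (fine \o g); have gE' : EFin \o (fine \o g) = g.
  by apply/funext => x /=; rewrite fineK.
split.
- apply/measurable_EFinP; rewrite gE'; exact: measurable_int gint.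
- by move=> x /=; exact: fine_ge0.
- by rewrite gE'.
- move=> s t s0 st t1; rewrite -tilt_measure_itv//.
  transitivity (nu1 `]s, t]%classic); last first.
    apply: (etrans (gE _ _)); first exact: measurable_itv.
    by apply: eq_integral => x _ /=; rewrite fineK.
  rewrite /nu1 /mfrestr /mrestr; congr (nu _).
  apply/seteqP; split=> [x /= xst|x []//]; split => //=.
  move: xst; rewrite /= !in_itv/= => /andP[sx xt].
  by rewrite (le_lt_trans s0 sx) (le_trans xt t1).
Qed.

End lipschitz_stieltjes.

Section lipschitz_derivative.
Context {R : realType}.
Local Notation la := (@lebesgue_measure R).

Lemma measurable_itvT (i : interval R) :
  measurable ([set` i] : set (measurableTypeR R)).
Proof. exact: measurable_itv. Qed.

Lemma lebesgue_measure_segment (s t : R) : s <= t ->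
  la (`[s, t]%classic : set R) = (t - s)%:E.
Proof.
move=> st; rewrite lebesgue_measure_itv/= lte_fin.
by case: ltgtP st => // -> _; rewrite subrr.
Qed.

Lemma bounded_integrable_itv (g : R -> R) (M : R) (i : interval R) :
  measurable_fun setT g -> (forall x, `|g x| <= M) -> (la [set` i] < +oo)%E ->
  la.-integrable [set` i] (EFin \o g).
Proof.
move=> mg gM fin; apply: measurable_bounded_integrable => //.
- exact: measurable_funTS.
- by exists M; split; [exact: num_real|move=> x Mx y _ /=; exact: le_trans (gM _) (ltW Mx)].
Qed.

(** Lebesgue's differentiation theorem, for a function known to be an
    indefinite integral on [0, 1] only. *)
Lemma indefinite_integral_derivable (g F : R -> R) :
  la.-integrable `[0, 1] (EFin \o g) ->
  (forall s t : R, 0 <= s -> s <= t -> t <= 1 ->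
    ((F t - F s)%:E = \int[la]_(x in `[s, t]) (g x)%:E)%E) ->
  {ae la, forall x : R, 0 < x < 1 -> is_derive x 1 F (g x)}.
Proof.
move=> gi FE; pose h := g \_ `[0, 1].
have hi : la.-integrable setT (EFin \o h).
  have -> : EFin \o h = (EFin \o g) \_ `[0, 1] by rewrite restrict_EFin.
  have mI : measurable (`[0, 1]%classic : set (measurableTypeR R)) by exact: measurable_itv.
  exact: (@integrable_mkcond _ _ R la _ _ mI).1.
have hiy y : la.-integrable [set` Interval (BLeft 0) (BRight y)] (EFin \o h).
  by apply: (integrableS measurableT) => //; exact: measurable_itv.
have := FTC1 hiy (integrable_locally (measurable_itv _) gi).
apply: filterS.
move=> x dx /andP[x0 x1].
have [] := dx; first by rewrite lte_fin.
set G := fun x => _ => dG G'.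
have hg y : 0 <= y <= 1 -> h y = g y.
  by move=> y01; rewrite /h patchE mem_set//= in_itv.
apply: (@near_eq_is_derive _ _ _ (cst (F 0) + G)).
  near=> y; transitivity (F 0 + fine (F y - F 0)%:E); last by rewrite /= addrC subrK.
  have y1 : y <= 1 by near: y; exact: lt_le_nbhsl.
  congr (_ + fine _); rewrite FE//; last by near: y; exact: lt_le_nbhsr.
  apply: eq_integral => z; rewrite inE/= in_itv/= => /andP[z0 zy].
  by rewrite hg// z0 (le_trans zy y1).
rewrite -hg ?(ltW x0) ?(ltW x1)// -[h x]add0r; apply: is_deriveD; apply: DeriveDef => //.
by rewrite -derive1E G'.
Unshelve. all: by end_near. Qed.

Lemma is_derive_quotient (f : R -> R) (x d : R) : is_derive x 1 f d ->
  (f (x + h) - f x) / h @[h --> 0^'] --> d.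
Proof.
move=> [df <-].
have /= h : h^-1 *: (f (h *: 1 + x) - f x) @[h --> 0^'] --> 'D_1 f x by [].
apply: (cvg_trans _ h); apply: near_eq_cvg; near=> k.
by rewrite /= [k%:A]mulr1 [_ *: _]mulrC (addrC x).
Unshelve. all: by end_near. Qed.

Lemma is_derive_norm_quotient (f : R -> R) (x d : R) : is_derive x 1 f d ->
  `|f (x + h) - f x| / `|h| @[h --> 0^'] --> `|d|.
Proof.
move=> /is_derive_quotient/cvg_norm; apply: cvg_trans; apply: near_eq_cvg.
by near=> k; rewrite normrM normfV.
Unshelve. all: by end_near. Qed.

(** A Lipschitz function is the integral of a bounded density: that of its
    tilt minus L, which is almost everywhere the derivative, and so can be
    truncated to [- L, L]. *)
Lemma lipschitz_density (f : R -> R) (L : R) : 0 < L ->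
  (forall s t, `|f s - f t| <= L * `|s - t|) ->
  exists g : R -> R, [/\ measurable_fun setT g, (forall x, `|g x| <= L) &
    forall s t : R, 0 <= s -> s <= t -> t <= 1 ->
    ((f t - f s)%:E = \int[la]_(x in `[s, t]) (g x)%:E)%E].
Proof.
move=> L0 fL; have [g0 [mg0 _ g0i g0E]] := tilt_measure_density fL L0.
have Li s t : la.-integrable `[s, t] (EFin \o cst L).
  apply: (@bounded_integrable_itv _ `|L|); [exact: measurable_cst|by move=> x|].
  by rewrite lebesgue_measure_itv/=; case: ifP => _; rewrite ?ltry// -EFinB ltry.
have g0i' s t : la.-integrable `[s, t] (EFin \o g0).
  by apply: (integrableS measurableT) => //; exact: measurable_itv.
have fE s t : 0 <= s -> s <= t -> t <= 1 ->
    ((f t - f s)%:E = \int[la]_(x in `[s, t]) (g0 x - L)%:E)%E.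
  move=> s_ge0 st t1; under eq_integral do rewrite EFinB.
  rewrite (integralB (measurable_itvT _) (g0i' s t) (Li s t)).
  have -> : (\int[la]_(x in `[s, t]) (EFin \o cst L) x = (L * (t - s))%:E)%E.
    transitivity (\int[la]_(x in `[s, t]) cst L%:E x)%E; first by [].
    rewrite integral_cst//.
    by rewrite EFinM; congr (_ * _)%E; exact: lebesgue_measure_segment.
  have -> : (\int[la]_(x in `[s, t]) (EFin \o g0) x = (tilt f L t - tilt f L s)%:E)%E.
    rewrite g0E// -integral_itv_obnd_cbnd//.
    by apply/measurable_EFinP; exact: measurable_funTS.
  rewrite -EFinB /tilt; congr EFin; ring.
pose g x := Num.max (- L) (Num.min L (g0 x - L)).
have mg : measurable_fun setT g.
  apply: measurable_maxr => //; apply: measurable_minr => //.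
  by apply: measurable_funB.
exists g; split => //.
  move=> x; rewrite /g ler_norml le_max lexx/= ge_max ge_min lexx/= andbT.
  by rewrite lerNl (le_trans _ (ltW L0))// lerNl oppr0 ltW.
move=> s t s0 st t1; rewrite fE//.
have g0Li : la.-integrable `[0, 1] (EFin \o (fun x => g0 x - L)).
  rewrite [X in _.-integrable _ X](_ : _ = ((EFin \o g0) \- (EFin \o cst L))%E); last by [].
  exact: (integrableB (measurable_itvT _) (g0i' 0 1) (Li 0 1)).
have mg0L : measurable_fun setT (fun x => g0 x - L) by exact: measurable_funB.
rewrite [LHS]integral_itv_bndoo; last by apply/measurable_EFinP; exact: measurable_funTS.
rewrite [RHS]integral_itv_bndoo; last by apply/measurable_EFinP; exact: measurable_funTS.
apply: ae_eq_integral => //; [by apply/measurable_EFinP; exact: measurable_funTS..|].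
have := indefinite_integral_derivable g0Li fE.
apply: filterS.
move=> x dx /=; rewrite in_itv/= => /andP[sx xt].
have /dx/is_derive_norm_quotient fx : 0 < x < 1 by rewrite (le_lt_trans s0 sx) (lt_le_trans xt t1).
have dL : `|g0 x - L| <= L.
  rewrite -(cvg_lim _ fx)//; apply: limr_le; first by apply: cvgP fx.
  near=> h; rewrite ler_pdivrMr; last by rewrite normr_gt0; near: h; exact: nbhs_dnbhs_neq.
  by rewrite (le_trans (fL _ _))// addrAC subrr add0r.
move: dL; rewrite ler_norml => /andP[d1 d2].
by congr EFin; rewrite /g (min_idPr d2) (max_idPr d1).
Unshelve. all: by end_near. Qed.

End lipschitz_derivative.

(** * Integrals of almost everywhere equal functions *)

Section integral_ae.
Context d (T : measurableType d) (R : realType).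
Variable mu : {measure set T -> \bar R}.
Local Open Scope ereal_scope.
Import HBNNSimple.

Let nnint_ae_le (f g : T -> \bar R) (N : set T) : measurable N -> mu N = 0 ->
  (forall x, 0 <= f x) -> (forall x, 0 <= g x) ->
  (forall x, ~ N x -> f x = g x) -> \int[mu]_x f x <= \int[mu]_x g x.
Proof.
move=> mN N0 f0 g0 fg; rewrite [leLHS]ge0_integralTE// [leRHS]ge0_integralTE//.
apply: ge_ereal_sup => _ [h hf <-].
apply: ereal_sup_ubound.
have mNC : measurable (~` N) by exact: measurableC.
exists (mul_nnsfun h (indic_nnsfun R mNC)).
  move=> x /=; rewrite mindicE; have [xN|xN] := pselect (N x).
    by rewrite memNset/= ?mulr0.
  by rewrite mem_set//= mulr1 -fg.
rewrite -!integralT_nnsfun; apply: ge0_ae_eq_integral => //.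
- exact/measurable_EFinP.
- exact/measurable_EFinP.
- by move=> x _ /=; rewrite lee_fin mulr_ge0.
- by move=> x _; rewrite lee_fin.
- exists N; split => // x /=; apply: contra_notP => xN _.
  by rewrite mindicE mem_set//= mulr1.
Qed.

(** The integral, being defined for all functions by approximation from below,
    depends on its integrand almost everywhere only, measurable or not. *)
Lemma ae_eq_integral_all (D : set T) (f g : T -> \bar R) :
  {ae mu, forall x, D x -> f x = g x} ->
  \int[mu]_(x in D) f x = \int[mu]_(x in D) g x.
Proof.
move=> [N [mN N0 fgN]]; rewrite [LHS]integral_mkcond [RHS]integral_mkcond.
have fg x : ~ N x -> (f \_ D) x = (g \_ D) x.
  move=> Nx; rewrite !patchE; case: ifPn => // /set_mem Dx.
  by apply: contrapT => fgx; apply: Nx; apply: fgN => /= /(_ Dx).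
rewrite [LHS]integralE [RHS]integralE; congr (_ - _);
  apply/eqP; rewrite eq_le; apply/andP; split;
  apply: (nnint_ae_le mN N0) => // x Nx; rewrite ?funeposE ?funenegE fg//.
Qed.

End integral_ae.

(** * Metric speed and length of Lipschitz curves *)

Section metric_speed.
Context {R : realType} {X : Type}.
Local Notation la := (@lebesgue_measure R).

(** The nearest point of [0, 1]. *)
Definition clamp (s : R) : R := Num.max 0 (Num.min 1 s).

Lemma clamp_itv s : 0 <= clamp s <= 1.
Proof. by rewrite /clamp le_max lexx/= ge_max ler01 ge_min lexx. Qed.

Lemma clamp_id s : 0 <= s <= 1 -> clamp s = s.
Proof. by move=> /andP[s0 s1]; rewrite /clamp (min_idPr s1) (max_idPr s0). Qed.

Lemma clamp_lipschitz s t : `|clamp s - clamp t| <= `|s - t|.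
Proof.
wlog st : s t / s <= t.
  move=> h; have [|/ltW ts] := leP s t; first exact: h.
  by rewrite distrC (distrC s); exact: h.
rewrite (distrC s) (ger0_norm (_ : 0 <= t - s)) ?subr_ge0//.
have cst : clamp s <= clamp t.
  by rewrite /clamp; apply: le_max2 => //; apply: le_min2.
rewrite distrC ger0_norm ?subr_ge0// /clamp.
rewrite /Num.max /Num.min.
by do !case: ifPn; rewrite -?leNgt; lra.
Qed.

(** An enumeration of the rational points of [0, 1]. *)
Definition rational01 (n : nat) : R := clamp (ratr (odflt 0 (unpickle n))).

Lemma rational01_dense t e : 0 <= t <= 1 -> 0 < e -> exists n, `|rational01 n - t| < e.
Proof.
move=> t01 e0.
have [q] := @rat_in_itvoo R (t - e) (t + e) ltac:(lra).
rewrite in_itv/= -ltr_distl => qt; exists (pickle q).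
rewrite /rational01 pickleK/= -[t in X in `|X|](clamp_id t01).
by apply: le_lt_trans (clamp_lipschitz _ _) _.
Qed.

Lemma ratr01 n : 0 <= rational01 n <= 1. Proof. exact: clamp_itv. Qed.

(** The primitive of a bounded measurable function on [0, 1] is Lipschitz. *)
Lemma bounded_primitive (m : R -> R) (L : R) : measurable_fun setT m ->
  (forall s, `|m s| <= L) -> exists M : R -> R,
  (forall s t : R, 0 <= s -> s <= t -> t <= 1 ->
    ((M t - M s)%:E = \int[la]_(x in `[s, t]) (m x)%:E)%E) /\
  (forall s t, `|M s - M t| <= L * `|s - t|).
Proof.
move=> mm mL.
have L_ge0 : 0 <= L by apply: le_trans (mL 0).
have mint s t : la.-integrable `[s, t] (EFin \o m).
  apply: (bounded_integrable_itv mm mL).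
  by rewrite lebesgue_measure_itv/=; case: ifP => _; rewrite ?ltry// -EFinB ltry.
pose M t := fine (\int[la]_(x in `[0%R, clamp t]) (m x)%:E)%E.
have ME (s t : R) : 0 <= s -> s <= t -> t <= 1 ->
    ((M t - M s)%:E = \int[la]_(x in `[s, t]) (m x)%:E)%E.
  move=> s0 st t1.
  rewrite /M !clamp_id ?s0 ?t1 ?(le_trans s0 st) ?(le_trans st t1)//.
  have := Rintegral_itvB (a := BLeft 0) (b := BRight t) (x := s) (mint 0 t).
  rewrite !bnd_simp => /(_ s0 st) MB.
  rewrite /Rintegral in MB *; rewrite MB fineK; last first.
    by rewrite integral_itv_obnd_cbnd//; [exact: integrable_fin_num|apply/measurable_EFinP; exact: measurable_funTS].
  by rewrite integral_itv_obnd_cbnd//; apply/measurable_EFinP; exact: measurable_funTS.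
have MB (s t : R) : 0 <= s -> s <= t -> t <= 1 -> `|M t - M s| <= L * (t - s).
  move=> s0 st t1; rewrite -lee_fin -[leLHS]/(`|(M t - M s)%:E|)%E ME//.
  apply: (le_trans (le_abse_integral _ _ _)) => //.
    by apply/measurable_EFinP; exact: measurable_funTS mm.
  rewrite EFinM -(lebesgue_measure_segment st).
  apply: integral_le_bound => //.
  - by apply/measurable_EFinP; exact: measurable_funTS mm.
  - by apply: aeW => x _; rewrite /= lee_fin.
exists M; split => // s t.
wlog st : s t / s <= t.
  move=> h; have [|/ltW ts] := leP s t; first exact: h.
  by rewrite distrC (distrC s); exact: h.
have cst : clamp s <= clamp t by rewrite /clamp; apply: le_max2 => //; apply: le_min2.
have -> : M s = M (clamp s) by rewrite /M (clamp_id (clamp_itv _)).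
have -> : M t = M (clamp t) by rewrite /M (clamp_id (clamp_itv _)).
have /andP[s0 _] := clamp_itv s; have /andP[_ t1] := clamp_itv t.
rewrite distrC (le_trans (MB _ _ s0 cst t1))// ler_wpM2l//.
by rewrite (le_trans _ (clamp_lipschitz s t))// distrC ler_norm.
Qed.

Lemma near_itv01 s : 0 < s < 1 -> \forall h \near (0 : R)^', 0 <= s + h <= 1.
Proof.
move=> s01; have d0 : 0 < Num.min s (1 - s).
  by rewrite lt_min subr_gt0; case/andP: s01 => -> ->.
near=> h; have : `|h| <= Num.min s (1 - s) by near: h; exact: dnbhs0_le.
rewrite le_min ler_norml ler_norml => /andP[/andP[h1 _] /andP[_ h2]]; lra.
Unshelve. all: by end_near. Qed.

Lemma ae_itv01 : {ae la, forall x : R, (`[0, 1]%classic : set R) x -> 0 < x < 1}.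
Proof.
have neg (a : R) : la.-negligible [set a].
  by exists [set a]; split => //; exact: lebesgue_measure_set1.
apply: negligibleS (negligibleU (neg 0) (neg 1)) => x /= /not_implyP[].
rewrite in_itv/= !le_eqVlt => /andP[/orP[/eqP<-|x0] /orP[/eqP->|x1]] h; try by [left|right].
by case: h; rewrite x0.
Qed.

Variables (D : X -> X -> \bar R) (c : R -> X) (L : R).
Hypothesis Ddist : pseudo_distance D.
Hypothesis L0 : 0 < L.
Hypothesis cL : forall s t, s \in `[0, 1] -> t \in `[0, 1] ->
  (D (c s) (c t) <= (L * `|s - t|)%:E)%E.

Let rd x y := fine (D x y).
Let DE x y : D x y = (rd x y)%:E.
Proof. by case: Ddist => /(_ x y)[? _] _ _ _; rewrite /rd fineK. Qed.
Let rdC x y : rd x y = rd y x.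
Proof. by rewrite /rd; case: Ddist => _ _ ->. Qed.
Let rd_tri x y z : rd x z <= rd x y + rd y z.
Proof. by case: Ddist => _ _ _ /(_ x y z); rewrite !DE -EFinD lee_fin. Qed.
Let rd_cL s t : 0 <= s <= 1 -> 0 <= t <= 1 -> rd (c s) (c t) <= L * `|s - t|.
Proof. by move=> s01 t01; rewrite -lee_fin -DE cL// in_itv. Qed.

Let f (n : nat) (s : R) : R := rd (c (clamp s)) (c (rational01 n)).

Let f_rd n s t : `|f n s - f n t| <= rd (c (clamp s)) (c (clamp t)).
Proof.
rewrite ler_norml; apply/andP; split; rewrite /f.
  have := rd_tri (c (clamp t)) (c (clamp s)) (c (rational01 n)).
  by rewrite (rdC (c (clamp t)) (c (clamp s))); lra.
have := rd_tri (c (clamp s)) (c (clamp t)) (c (rational01 n)); lra.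
Qed.

Let f_lip n s t : `|f n s - f n t| <= L * `|s - t|.
Proof.
apply: (le_trans (f_rd _ _ _)); apply: (le_trans (rd_cL (clamp_itv _) (clamp_itv _))).
by rewrite ler_pM2l// clamp_lipschitz.
Qed.

(** The metric speed of a Lipschitz curve exists almost everywhere, and the
    distance between two points of the curve is at most its integral. It is the
    supremum m of the absolute values of the derivatives of the functions
    f n, the distances to a dense sequence of points of the curve. *)
Lemma metric_speed_density : exists m : R -> R,
  [/\ measurable_fun setT m, forall s, 0 <= m s <= L,
    forall s t : R, 0 <= s -> s <= t -> t <= 1 ->
      (D (c s) (c t) <= \int[la]_(x in `[s, t]) (m x)%:E)%E &
    {ae la, forall s : R, 0 < s < 1 ->
      fine (D (c (s + h)) (c s)) / `|h| @[h --> 0^'] --> m s}].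
Proof.
have /choice[g /all_and3[mg gL gE]] : forall n, exists g : R -> R,
    [/\ measurable_fun setT g, (forall x, `|g x| <= L) &
    forall s t : R, 0 <= s -> s <= t -> t <= 1 ->
    ((f n t - f n s)%:E = \int[la]_(x in `[s, t]) (g x)%:E)%E].
  by move=> n; exact: (lipschitz_density L0 (f_lip n)).
pose m s := sups (fun n => `|g n s|) 0.
have ub s : has_ubound (range (fun n => `|g n s|)) by exists L => _ [n _ <-].
have mE s : m s = sup (range (fun n => `|g n s|)).
  rewrite /m /sups /sdrop; congr sup; apply/seteqP; split.
    by move=> _ [k _ <-]; exists k.
  by move=> _ [k _ <-]; exists k.
have gm n s : `|g n s| <= m s by rewrite mE; apply: ub_le_sup; [exact: ub|exists n].
have m0 s : 0 <= m s by apply: le_trans (gm 0%N s).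
have mL s : m s <= L.
  by rewrite mE; apply: ge_sup; [exists `|g 0%N s|; exists 0%N|move=> _ [k _ <-]].
have m_approx s e : 0 < e -> exists n, m s - e < `|g n s|.
  move=> e0; have hs : has_sup (range (fun n => `|g n s|)).
    by split; [exists `|g 0%N s|; exists 0%N|exact: ub].
  by have [_ [n _ <-] h] := sup_adherent e0 hs; exists n; rewrite mE.
have mm : measurable_fun setT m.
  by apply: measurable_fun_sups => // n; apply: measurableT_comp.
have mabs s : `|m s| <= L by rewrite ger0_norm.
have itv_fin (s t : R) : (la `[s, t] < +oo)%E.
  by rewrite lebesgue_measure_itv/=; case: ifP => _; rewrite ?ltry// -EFinB ltry.
have [M [ME _]] := bounded_primitive mm mabs.
have mint : la.-integrable `[0, 1] (EFin \o m) by exact: (bounded_integrable_itv mm mabs).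
have fM n (s t : R) : 0 <= s -> s <= t -> t <= 1 -> `|f n t - f n s| <= M t - M s.
  move=> s0 st t1; rewrite -lee_fin ME// -[leLHS]/(`|(f n t - f n s)%:E|)%E gE//.
  apply: (le_trans (le_abse_integral _ _ _)) => //.
    by apply/measurable_EFinP; exact: measurable_funTS (mg n).
  apply: ge0_le_integral => //.
  - by apply/measurable_EFinP; apply: measurableT_comp => //; exact: measurable_funTS (mg n).
  - by apply/measurable_EFinP; exact: measurable_funTS.
  - by move=> x _; rewrite /= lee_fin.
have rdM (s t : R) : 0 <= s -> s <= t -> t <= 1 -> rd (c s) (c t) <= M t - M s.
  move=> s0 st t1; apply/ler_addgt0Pr => e e0.
  have t01 : 0 <= t <= 1 by rewrite (le_trans s0 st).
  have s01 : 0 <= s <= 1 by rewrite s0 (le_trans st t1).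
  have [n nt] := rational01_dense t01 (divr_gt0 e0 (mulr_gt0 (ltr0n _ 2) L0)).
  have fnt : f n t <= e / 2.
    rewrite /f clamp_id//; apply: (le_trans (rd_cL t01 (ratr01 n))).
    rewrite distrC (le_trans (ler_wpM2l (ltW L0) (ltW nt)))//.
    rewrite le_eqVlt; apply/orP; left; apply/eqP; field.
    by rewrite gt_eqF.
  have fns : rd (c s) (c t) <= f n s + f n t.
    by rewrite /f !clamp_id// (rdC (c t)) rd_tri.
  have := fM n s t s0 st t1; rewrite ler_norml => /andP[h _]; lra.
exists m; split => //.
- by move=> s; rewrite m0 mL.
- by move=> s t s0 st t1; rewrite -ME// DE lee_fin rdM.
have dM := indefinite_integral_derivable mint ME.
have dg : {ae la, forall (s : R) (n : nat), 0 < s < 1 -> is_derive s 1 (f n) (g n s)}.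
  apply: ae_foralln => n; apply: (indefinite_integral_derivable _ (gE n)).
  exact: (bounded_integrable_itv (mg n) (gL n)).
move: dM dg; apply: filterS2 => s dMs dfs s01.
have {}dMs := is_derive_norm_quotient (dMs s01).
have {}dfs n := is_derive_norm_quotient (dfs n s01).
have s01' : 0 <= s <= 1 by case/andP: s01 => ? ?; rewrite !ltW.
apply/cvgrPdist_le => e e0.
have [n mn] := m_approx s _ (divr_gt0 e0 (ltr0n _ 2)).
have e20 : 0 < e / 2 by rewrite divr_gt0.
have nsh := near_itv01 s01.
near=> h.
have h0 : 0 < `|h| by rewrite normr_gt0; near: h; exact: nbhs_dnbhs_neq.
have sh01 : 0 <= s + h <= 1.
  by near: h; exact: nsh.
have up : rd (c (s + h)) (c s) / `|h| <= `|M (s + h) - M s| / `|h|.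
  rewrite ler_pM2r ?invr_gt0//.
  case/andP: sh01 => sh0 sh1; case/andP: s01' => s0 s1.
  have [hs|/ltW hs] := leP s (s + h).
    by rewrite rdC (le_trans (rdM _ _ s0 hs sh1))// ler_norm.
  by rewrite (le_trans (rdM _ _ sh0 hs s1))// distrC ler_norm.
have lo : `|f n (s + h) - f n s| / `|h| <= rd (c (s + h)) (c s) / `|h|.
  rewrite ler_pM2r ?invr_gt0// (le_trans (f_rd _ _ _))// !clamp_id//.
have : `| `|m s| - `|M (s + h) - M s| / `|h| | <= e / 2.
  by near: h; apply: cvgr_dist_le.
have : `| `|g n s| - `|f n (s + h) - f n s| / `|h| | <= e / 2.
  by near: h; apply: cvgr_dist_le.
rewrite (ger0_norm (m0 s)) !ler_distl => /andP[_ h1] /andP[h2 _].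
rewrite -/(rd _ _); apply/andP; split; lra.
Unshelve. all: by end_near. Qed.

(** The real limit of the difference quotients is the value of the extended
    real limit that defines the metric speed. *)
Lemma cvg_metric_speed s l :
  fine (D (c (s + h)) (c s)) / `|h| @[h --> 0^'] --> l ->
  metric_speed D c s = l%:E.
Proof.
move=> hl; rewrite /metric_speed; apply: cvg_lim; first exact: ereal_hausdorff.
have -> : (fun h => D (c (s + h)) (c s) * (`|h|^-1)%:E)%E =
    EFin \o (fun h => fine (D (c (s + h)) (c s)) / `|h|).
  by apply/funext => h /=; rewrite DE -EFinM.
exact: (@cvg_comp _ _ _ _ EFin _ (nbhs l)).
Qed.

Local Notation length := (\int[la]_(s in `[0%R, 1%R]) metric_speed D c s)%E.

(** The length of a Lipschitz curve is the increment over [0, 1] of a Lipschitz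
    function whose increments bound the distances along the curve. *)
Lemma length_primitive : exists M : R -> R,
  [/\ forall s t, `|M s - M t| <= L * `|s - t|,
    forall s t : R, 0 <= s -> s <= t -> t <= 1 ->
      (D (c s) (c t) <= (M t - M s)%:E)%E &
    length = (M 1 - M 0)%:E].
Proof.
have [m [mm m0L mD maeD]] := metric_speed_density.
have mL s : `|m s| <= L by have /andP[m0 mL] := m0L s; rewrite ger0_norm.
have [M [ME ML]] := bounded_primitive mm mL.
exists M; split => //; first by move=> s t s0 st t1; rewrite ME// mD.
rewrite ME//; apply: ae_eq_integral_all.
move: maeD ae_itv01; apply: filterS2 => s hs s01 /s01/hs; exact: cvg_metric_speed.
Qed.

(** Conversely, any such function bounds the length. *)
Lemma length_le (V : R -> R) (k : R) : 0 < k ->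
  (forall s t, `|V s - V t| <= k * `|s - t|) ->
  (forall s t : R, 0 <= s -> s <= t -> t <= 1 ->
      (D (c s) (c t) <= (V t - V s)%:E)%E) ->
  (length <= (V 1 - V 0)%:E)%E.
Proof.
move=> k0 Vk DV; have [m [mm m0L mD maeD]] := metric_speed_density.
have [v [mv vk vE]] := lipschitz_density k0 Vk.
have vi : la.-integrable `[0, 1] (EFin \o v).
  by apply: (bounded_integrable_itv mv vk); rewrite lebesgue_measure_segment// ltry.
have dV := indefinite_integral_derivable vi vE.
have mv' : {ae la, forall s : R, 0 < s < 1 -> m s <= v s}.
  move: maeD dV; apply: filterS2 => s hs dVs s01.
  have {}dVs := is_derive_quotient (dVs s01); have {}hs := hs s01.
  apply: (ler_cvg_to hs dVs); have nsh := near_itv01 s01; near=> h.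
  have h0 : h != 0 by near: h; exact: nbhs_dnbhs_neq.
  have /andP[sh0 sh1] : 0 <= s + h <= 1 by near: h; exact: nsh.
  case/andP: s01 => /ltW s0 /ltW s1.
  have [hs0|hs0] := ltP h 0.
    rewrite ltr0_norm// invrN mulrN -mulNr ler_nM2r ?invr_lt0//.
    rewrite lerNr opprB -lee_fin -/(rd _ _) -DE DV//; lra.
  have {h0}hs0 : 0 < h by rewrite lt_def h0.
  rewrite gtr0_norm// ler_pM2r ?invr_gt0// -/(rd _ _) rdC.
  by rewrite -lee_fin -DE DV//; lra.
have mL s : `|m s| <= L by have /andP[m0 mL] := m0L s; rewrite ger0_norm.
have mi : la.-integrable `[0, 1] (EFin \o m).
  by apply: (bounded_integrable_itv mm mL); rewrite lebesgue_measure_segment// ltry.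
rewrite vE//; have -> : length = (\int[la]_(s in `[0%R, 1%R]) (m s)%:E)%E.
  apply: ae_eq_integral_all.
  move: maeD ae_itv01; apply: filterS2 => s hs s01 /s01/hs; exact: cvg_metric_speed.
pose w s := Num.max (v s) 0.
have mw : measurable_fun setT w by exact: measurable_maxr.
have -> : (\int[la]_(s in `[0%R, 1%R]) (v s)%:E = \int[la]_(s in `[0%R, 1%R]) (w s)%:E)%E.
  apply: ae_eq_integral_all.
  move: mv' ae_itv01; apply: filterS2 => s hs s01 /s01/hs ms.
  by rewrite /w max_l// (le_trans _ ms)//; have /andP[] := m0L s.
apply: ae_ge0_le_integral => //.
- by move=> s _; rewrite lee_fin; have /andP[] := m0L s.
- by apply/measurable_EFinP; exact: measurable_funTS mm.
- by move=> s _; rewrite lee_fin le_max lexx orbT.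
- by apply/measurable_EFinP; exact: measurable_funTS mw.
- move: mv' ae_itv01; apply: filterS2 => s hs s01 /s01/hs ms.
  by rewrite lee_fin le_max ms.
Unshelve. all: by end_near. Qed.

End metric_speed.

(** * Approximate gluing of probabilities *)

Section probability_constructions.
Local Open Scope ereal_scope.

Lemma image_probability d1 d2 (T1 : measurableType d1) (T2 : measurableType d2)
    (R : realType) (P : probability T1 R) (f : T1 -> T2) :
  measurable_fun setT f ->
  exists Q : probability T2 R, forall A, Q A = P (f @^-1` A).
Proof.
move=> mf; pose F : {mfun T1 >-> T2} := HB.pack f (isMeasurableFun.Build _ _ _ _ _ mf).
by exists (distribution P F).
Qed.

Lemma unit_mass_probability d (T : measurableType d) (R : realType)
    (mu : {measure set T -> \bar R}) : mu setT = 1 ->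
  exists P : probability T R, forall A, P A = mu A.
Proof.
move=> mu1.
exists (mnormalize mu \d_point) => A.
by rewrite /= /mnormalize mu1 onee_eq0/= invr1 mule1.
Qed.

Let approximate_gluing_measure d1 d2 d3 (T1 : measurableType d1)
    (T2 : measurableType d2) (T3 : measurableType d3) (R : realType)
    (P : probability (T1 * T2)%type R) (Q : probability (T2 * T3)%type R)
    (A : nat -> set T2) :
  (forall B, measurable B -> P (snd @^-1` B) = Q (fst @^-1` B)) ->
  (forall i, measurable (A i)) -> trivIset setT A -> \bigcup_i A i = setT ->
  exists W : {measure set ((T1 * T2) * (T2 * T3))%type -> \bar R},
    [/\ forall E, measurable E -> W (fst @^-1` E) = P E,
        forall E, measurable E -> W (snd @^-1` E) = Q E &
        {ae W, forall z, exists i, A i z.1.2 /\ A i z.2.1}].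
Proof.
move=> PQ mA tA UA.
pose B i : set ((T1 * T2) * (T2 * T3)) := (snd @^-1` A i) `*` (fst @^-1` A i).
have mA1 i : measurable (snd @^-1` A i : set (T1 * T2)).
  by rewrite -[X in measurable X]setTI; exact: measurable_snd.
have mA2 i : measurable (fst @^-1` A i : set (T2 * T3)).
  by rewrite -[X in measurable X]setTI; exact: measurable_fst.
have mB i : measurable (B i) by exact: measurableX.
pose a i := fine (P (snd @^-1` A i)).
have aP i : P (snd @^-1` A i) = (a i)%:E by rewrite /a fineK// fin_num_measure.
have aQ i : Q (fst @^-1` A i) = (a i)%:E by rewrite -PQ.
have a0 i : (0 <= (a i)^-1)%R by rewrite invr_ge0 -lee_fin -aP measure_ge0.
(* For a null piece the inverse of its mass is 0, and the piece is dropped. *)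
pose W := mseries (fun i => mscale (NngNum (a0 i)) (mrestr (P \x Q) (mB i))) 0.
have WX E F : measurable E -> measurable F -> W (E `*` F) =
    \sum_(0 <= i <oo) ((a i)^-1)%:E * (P (E `&` snd @^-1` A i) * Q (F `&` fst @^-1` A i)).
  move=> mE mF; apply: eq_eseriesr => i _; rewrite /mscale/= /mrestr; congr (_ * _).
  rewrite -product_measure1E//; [|exact: measurableI..].
  congr (product_measure1 P Q _).
  by apply/seteqP; split => z /=; rewrite /B/=; tauto.
have aV i (u : \bar R) : 0 <= u <= (a i)%:E -> ((a i)^-1)%:E * (u * (a i)%:E) = u.
  move=> /andP[u0 ua]; have [ai0|ai0] := eqVneq (a i) 0%R.
    rewrite ai0 mule0 mule0; apply/eqP; rewrite eq_le; apply/andP; split => //.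
    by rewrite (le_trans ua)// ai0.
  by rewrite muleCA -EFinM mulVf// mule1.
exists W; split.
- move=> E mE; rewrite -setXT; apply: (etrans (WX _ _ mE measurableT)).
  transitivity (\sum_(0 <= i <oo) P (E `&` snd @^-1` A i)).
    apply: eq_eseriesr => i _; rewrite setTI aQ aV// measure_ge0/= -aP.
    by apply: le_measure; rewrite ?inE//; exact: measurableI.
  rewrite -measure_semi_bigcup//.
  + by rewrite -setI_bigcupr -preimage_bigcup UA preimage_setT setIT.
  + by move=> i; exact: measurableI.
  + by move=> i j _ _ [x [[_ /= xi] [_ xj]]]; apply: tA => //; exists x.2.
  + by rewrite -setI_bigcupr -preimage_bigcup UA preimage_setT setIT.
- move=> F mF; rewrite -setTX; apply: (etrans (WX _ _ measurableT mF)).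
  transitivity (\sum_(0 <= i <oo) Q (F `&` fst @^-1` A i)).
    apply: eq_eseriesr => i _; rewrite setTI aP (muleC (a i)%:E) aV// measure_ge0/= -aQ.
    by apply: le_measure; rewrite ?inE//; exact: measurableI.
  rewrite -measure_semi_bigcup//.
  + by rewrite -setI_bigcupr -preimage_bigcup UA preimage_setT setIT.
  + by move=> i; exact: measurableI.
  + by move=> i j _ _ [x [[_ /= xi] [_ xj]]]; apply: tA => //; exists x.1.
  + by rewrite -setI_bigcupr -preimage_bigcup UA preimage_setT setIT.
- exists (~` \bigcup_i B i); split.
  + by apply: measurableC; exact: bigcup_measurable.
  + apply: eseries0 => i _ _.
    transitivity (((a i)^-1)%:E * (P \x Q) (~` (\bigcup_i B i) `&` B i)) => //.
    rewrite (_ : _ `&` B i = set0) ?measure0 ?mule0//.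
    by apply/seteqP; split => // z [] /= h Bz; apply: h; exists i.
  + by move=> z /= h [i _ Bz]; apply: h; exists i.
Qed.

(** Approximate gluing: two probabilities with a common marginal on T2 can be
    joined in such a way that the two points of T2 almost surely fall in the
    same piece of a given countable partition. *)
Lemma approximate_gluing d1 d2 d3 (T1 : measurableType d1)
    (T2 : measurableType d2) (T3 : measurableType d3) (R : realType)
    (P : probability (T1 * T2)%type R) (Q : probability (T2 * T3)%type R)
    (A : nat -> set T2) :
  (forall B, measurable B -> P (snd @^-1` B) = Q (fst @^-1` B)) ->
  (forall i, measurable (A i)) -> trivIset setT A -> \bigcup_i A i = setT ->
  exists W : probability ((T1 * T2) * (T2 * T3))%type R,
    [/\ forall E, measurable E -> W (fst @^-1` E) = P E,
        forall E, measurable E -> W (snd @^-1` E) = Q E &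
        {ae W, forall z, exists i, A i z.1.2 /\ A i z.2.1}].
Proof.
move=> PQ mA tA UA.
have [W [W1 W2 WN]] := approximate_gluing_measure PQ mA tA UA.
have WT : W setT = 1 by rewrite -(preimage_setT fst) W1// probability_setT.
have [Wp WpE] := unit_mass_probability WT; exists Wp; split.
- by move=> E mE; rewrite WpE W1.
- by move=> E mE; rewrite WpE W2.
- by case: WN => N [mN N0 ZN]; exists N; split => //; exact: etrans (WpE _) N0.
Qed.

End probability_constructions.

(** * The Wasserstein distance *)

Lemma ge0_integral_image d1 d2 (T1 : measurableType d1) (T2 : measurableType d2)
    (R : realType) (P : {measure set T1 -> \bar R}) (Q : {measure set T2 -> \bar R})
    (f : T1 -> T2) (g : T2 -> \bar R) : measurable_fun setT f ->
  (forall A, measurable A -> Q A = P (f @^-1` A)) ->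
  measurable_fun setT g -> (forall x, 0 <= g x)%E ->
  (\int[Q]_x g x = \int[P]_x g (f x))%E.
Proof.
move=> mf QP mg g0.
have := ge0_integral_pushforward mf P measurableT mg (fun x _ => g0 x).
rewrite preimage_setT => <-; apply: eq_measure_integral => A mA _; exact: QP.
Qed.

Section wasserstein.
Context {R : realType} {X : completeMetricType R}.
Implicit Types (mu nu : probability (borel X) R).
Local Open Scope ereal_scope.

Lemma mdist_ball_open (x : X) (r : R) : open [set y : X | (mdist x y < r)%R].
Proof.
rewrite openE => y /= xy; rewrite /interior.
have r0 : (0 < r - mdist x y)%R by rewrite subr_gt0.
apply: filterS (nbhsx_ballx y _ r0) => z; rewrite ballEmdist/= => yz.
by rewrite (le_lt_trans (metric_triangle x y z))// -ltrBrDl.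
Qed.

Lemma open_mdistP (U : set X) x : open U -> U x ->
  exists2 r : R, (0 < r)%R & [set y | (mdist x y < r)%R] `<=` U.
Proof.
rewrite openE => oU Ux; have /nbhs_ballP[r r0 rU] := oU x Ux.
by exists r => // y xy; apply: rU; rewrite ballEmdist.
Qed.

Lemma measurable_open (U : set X) : open U -> measurable (U : set (borel X)).
Proof. by move=> oU; exact: sub_gen_smallest. Qed.

Lemma measurable_mdistl (x : X) :
  measurable_fun setT (fun y : borel X => mdist x (y : X)).
Proof.
apply: (measurability _ (RGenInftyO.measurableE R)) => _ [_ [a ->] <-].
rewrite setTI; apply: measurable_open.
rewrite (_ : _ @^-1` _ = [set y : X | (mdist x y < a)%R]); first exact: mdist_ball_open.
by apply/seteqP; split => y /=; rewrite in_itv.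
Qed.

Hypothesis sepX : @separable_space R X.

Lemma separable_sequence : exists q : nat -> X,
  forall x (e : R), (0 < e)%R -> exists n, (mdist x (q n) < e)%R.
Proof.
have [S /countable_injP[f finj] dS] := sepX.
exists (fun n => xget point [set x | S x /\ f x = n]) => x e e0.
have [y [xy Sy]] : [set y : X | (mdist x y < e)%R] `&` S !=set0.
  by apply: dS; [exists x => /=; rewrite mdistxx|exact: mdist_ball_open].
exists (f y); case: xgetP => [z _ [Sz fz]|/(_ y)/not_andP[]//].
by rewrite (finj z y) ?inE.
Qed.

(** The Borel sets of the two factors suffice to measure the distance, because
    the space is separable. *)
Lemma measurable_mdist :
  measurable_fun setT (fun z : borel X * borel X => mdist (z.1 : X) (z.2 : X)).
Proof.
have [q qd] := separable_sequence.
apply: (measurability _ (RGenInftyO.measurableE R)) => _ [_ [a ->] <-].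
rewrite setTI.
rewrite (_ : _ @^-1` _ = \bigcup_n [set z : borel X * borel X |
    (mdist (q n) (z.1 : X) + mdist (q n) (z.2 : X) < a)%R]); last first.
  apply/seteqP; split => [[y z]/=|[y z] [n _ /=]]; rewrite in_itv/=.
    move=> yz; have e0 : (0 < (a - mdist y z) / 2)%R by rewrite divr_gt0// subr_gt0.
    have [n yn] := qd y _ e0; exists n => //=.
    have := metric_triangle (q n) y z; rewrite (metric_sym (q n) y); lra.
  apply: le_lt_trans; rewrite (metric_sym (q n) y); exact: metric_triangle.
apply: bigcup_measurable => n _.
have mf : measurable_fun setT (fun z : borel X * borel X =>
    (mdist (q n) (z.1 : X) + mdist (q n) (z.2 : X))%R).
  apply: measurable_funD.
  - exact: (measurableT_comp (measurable_mdistl (q n)) measurable_fst).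
  - exact: (measurableT_comp (measurable_mdistl (q n)) measurable_snd).
rewrite (_ : [set z | _] = setT `&`
  (fun z : borel X * borel X => (mdist (q n) (z.1 : X) + mdist (q n) (z.2 : X))%R) @^-1` `]-oo, a[).
  by apply: mf => //.
by rewrite setTI; apply/seteqP; split => y /=; rewrite in_itv.
Qed.


(** The quadratic transport cost of a plan. *)
Definition cost (pi : probability (borel X * borel X)%type R) : \bar R :=
  \int[pi]_z (mdist (z.1 : X) (z.2 : X) ^+ 2)%:E.

Lemma measurable_mdist_sq : measurable_fun setT
  (fun z : borel X * borel X => (mdist (z.1 : X) (z.2 : X) ^+ 2)%:E).
Proof. by apply/measurable_EFinP; apply: measurable_funX; exact: measurable_mdist. Qed.

Lemma cost_ge0 pi : 0 <= cost pi.
Proof. by apply: integral_ge0 => z _; rewrite lee_fin sqr_ge0. Qed.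

Lemma W2_ge0 mu nu : 0 <= W2 mu nu. Proof. exact: sqrte_ge0. Qed.

Lemma W2_sqr mu nu : W2 mu nu ^+ 2 = ereal_inf (cost @` coupling mu nu).
Proof.
by rewrite /W2 sqr_sqrte//; apply: le_ereal_inf_tmp => _ [pi _ <-]; exact: cost_ge0.
Qed.

Lemma W2_lt mu nu (r : R) : (0 <= r)%R -> W2 mu nu < r%:E ->
  exists2 pi, coupling mu nu pi & cost pi < (r ^+ 2)%:E.
Proof.
move=> r0 Wr; have : ereal_inf (cost @` coupling mu nu) < (r ^+ 2)%:E.
  by rewrite -W2_sqr EFin_expe lte_sqr ?W2_ge0 ?lee_fin.
by move=> /ereal_inf_lt[_ [pi cpi <-] ?]; exists pi.
Qed.

Lemma W2_le mu nu (r : R) pi : (0 <= r)%R -> coupling mu nu pi ->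
  cost pi <= (r ^+ 2)%:E -> W2 mu nu <= r%:E.
Proof.
move=> r0 cpi cr; rewrite -(ger0_norm r0) -sqrtr_sqr.
rewrite -[leRHS]/(sqrte (r ^+ 2)%:E) lee_sqrt ?lee_fin ?sqr_ge0//.
by apply: le_trans cr; apply: ereal_inf_lbound; exists pi.
Qed.

Lemma W2_eq mu nu mu' nu' : measure_eq mu mu' -> measure_eq nu nu' ->
  W2 mu nu = W2 mu' nu'.
Proof.
move=> mm nn; rewrite /W2; congr (sqrte (ereal_inf _)).
apply/seteqP; split => _ [pi cpi <-]; exists pi => // A mA; have [-> ->] := cpi A mA.
  by rewrite mm// nn.
by rewrite mm// nn.
Qed.

Let W2_sym_le mu nu : W2 nu mu <= W2 mu nu.
Proof.
rewrite /W2 lee_sqrt; last by apply: le_ereal_inf_tmp => _ [pi _ <-]; exact: cost_ge0.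
apply: le_ereal_inf_tmp => _ [pi cpi <-].
have mswap : measurable_fun setT (fun z : borel X * borel X => (z.2, z.1)).
  by apply/measurable_fun_pairP; split; [exact: measurable_snd|exact: measurable_fst].
have [pi' pi'E] := image_probability pi mswap.
apply: ereal_inf_lbound; exists pi'.
  by move=> A mA; rewrite !pi'E; have [<- <-] := cpi A mA.
rewrite (ge0_integral_image (P := pi) mswap).
- by apply: eq_integral => z _; rewrite metric_sym.
- by move=> A _; exact: pi'E.
- exact: measurable_mdist_sq.
- by move=> z; rewrite lee_fin sqr_ge0.
Qed.

Lemma W2_sym mu nu : W2 mu nu = W2 nu mu.
Proof. by apply/eqP; rewrite eq_le !W2_sym_le. Qed.

Lemma W2_refl mu : W2 mu mu = 0.
Proof.
have mdiag : measurable_fun setT (fun x : borel X => (x, x)).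
  by apply/measurable_fun_pairP; split; exact: measurable_id.
have [pi piE] := image_probability mu mdiag.
apply/eqP; rewrite eq_le W2_ge0 andbT; apply: (@W2_le _ _ 0%R pi) => //.
rewrite /cost (ge0_integral_image (P := mu) mdiag).
- by rewrite integral0_eq// => x _; rewrite mdistxx expr0n.
- by move=> A _; exact: piE.
- exact: measurable_mdist_sq.
- by move=> z; rewrite lee_fin sqr_ge0.
Qed.

End wasserstein.

Section wasserstein_triangle.
Context {R : realType} {X : completeMetricType R}.
Implicit Types (mu nu : probability (borel X) R).
Hypothesis sepX : @separable_space R X.
Local Open Scope ereal_scope.

(** Separable spaces have countable measurable partitions into small pieces. *)
Lemma small_partition (e : R) : (0 < e)%R -> exists A : nat -> set (borel X),
  [/\ forall i, measurable (A i), trivIset setT A, \bigcup_i A i = setT &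
      forall i x y, A i x -> A i y -> (mdist (x : X) (y : X) <= e)%R].
Proof.
move=> e0; have [q qd] := separable_sequence sepX.
pose B i : set (borel X) := [set y : X | (mdist (q i) y < e / 2)%R].
exists (seqDU B); split.
- apply: seqDU_measurable => i; apply: measurable_open; exact: mdist_ball_open.
- exact: trivIset_seqDU.
- rewrite -seqDU_bigcup_eq; apply/seteqP; split => // x _.
  have [n xn] := qd x (e / 2)%R ltac:(by rewrite divr_gt0).
  by exists n => //; rewrite /B/= metric_sym.
- move=> i x y Ax Ay; have Bx := subset_seqDU Ax; have By := subset_seqDU Ay.
  have := metric_triangle (x : X) (q i) (y : X); rewrite (metric_sym (x : X) (q i)).
  by rewrite /B/= in Bx By; lra.
Qed.

(* The Cauchy-Schwarz inequality with weights a, b and e. *)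
Let weighted_square (a b e x y z : R) : (0 < a -> 0 < b -> 0 < e ->
  0 <= z -> 0 <= x -> 0 <= y -> z <= x + y + e ->
  z ^+ 2 <= (a + b + e) / a * x ^+ 2 + (a + b + e) / b * y ^+ 2 + (a + b + e) * e)%R.
Proof.
move=> a0 b0 e0 z0 x0 y0 zle.
apply: (@le_trans _ _ ((x + y + e) ^+ 2)%R).
  by rewrite ler_pXn2r// nnegrE; lra.
rewrite -subr_ge0.
rewrite (_ : (_ - _)%R = (a * b * (x / a - y / b) ^+ 2 + a * e * (x / a - 1) ^+ 2
   + b * e * (y / b - 1) ^+ 2)%R); last by field; rewrite !gt_eqF.
by rewrite !addr_ge0// mulr_ge0 ?sqr_ge0// mulr_ge0// ltW.
Qed.

(** The triangle inequality up to the size e of the pieces of a partition: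
    approximate gluing of two plans gives a plan between the extreme marginals,
    whose cost is estimated with weights that make the constants match. *)
Lemma W2_glue (mu1 mu2 mu3 : probability (borel X) R) P Q (a b e : R) :
  (0 < a)%R -> (0 < b)%R -> (0 < e)%R ->
  coupling mu1 mu2 P -> coupling mu2 mu3 Q ->
  cost P <= (a ^+ 2)%:E -> cost Q <= (b ^+ 2)%:E ->
  W2 mu1 mu3 <= (a + b + e)%:E.
Proof.
move=> a0 b0 e0 cP cQ Pa Qb.
have [A [mA tA UA Ae]] := small_partition e0.
have PQ B : measurable B -> P (snd @^-1` B) = Q (fst @^-1` B).
  by move=> mB; have [_ ->] := cP B mB; have [-> _] := cQ B mB.
have [W [W1 W2' WA]] := approximate_gluing PQ mA tA UA.
pose phi (z : (borel X * borel X) * (borel X * borel X)) := (z.1.1, z.2.2).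
have mphi : measurable_fun setT phi.
  apply/measurable_fun_pairP; split.
    exact: (measurableT_comp measurable_fst measurable_fst).
  exact: (measurableT_comp measurable_snd measurable_snd).
have [S SE] := image_probability W mphi.
have mfstX (B : set (borel X)) : measurable B ->
    measurable (fst @^-1` B : set (borel X * borel X)).
  by move=> mB; rewrite -[Y in measurable Y]setTI; exact: measurable_fst.
have msndX (B : set (borel X)) : measurable B ->
    measurable (snd @^-1` B : set (borel X * borel X)).
  by move=> mB; rewrite -[Y in measurable Y]setTI; exact: measurable_snd.
have cS : coupling mu1 mu3 S.
  move=> B mB; rewrite !SE; split.
    have [<- _] := cP B mB; rewrite -W1; last exact: mfstX.
    by congr (W _).
  have [_ <-] := cQ B mB; rewrite -W2'; last exact: msndX.
  by congr (W _).
have msq := measurable_mdist_sq sepX.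
apply: (W2_le _ cS); first by rewrite !addr_ge0// ltW.
rewrite /cost (ge0_integral_image (P := W) mphi) => //; last 2 first.
- by move=> B _; exact: SE.
- by move=> z; rewrite lee_fin sqr_ge0.
pose u (z : (borel X * borel X) * (borel X * borel X)) :=
  (mdist (z.1.1 : X) (z.1.2 : X) ^+ 2)%:E.
pose v (z : (borel X * borel X) * (borel X * borel X)) :=
  (mdist (z.2.1 : X) (z.2.2 : X) ^+ 2)%:E.
have mu_ : measurable_fun setT u by exact: (measurableT_comp msq measurable_fst).
have mv_ : measurable_fun setT v by exact: (measurableT_comp msq measurable_snd).
have u0 z : 0 <= u z by rewrite lee_fin sqr_ge0.
have v0 z : 0 <= v z by rewrite lee_fin sqr_ge0.
have uE : \int[W]_z u z = cost P.
  rewrite /cost; symmetry; apply: (ge0_integral_image (P := W) measurable_fst) => //.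
  - by move=> B mB; symmetry; exact: W1.
  - by move=> z; rewrite lee_fin sqr_ge0.
have vE : \int[W]_z v z = cost Q.
  rewrite /cost; symmetry; apply: (ge0_integral_image (P := W) measurable_snd) => //.
  - by move=> B mB; symmetry; exact: W2'.
  - by move=> z; rewrite lee_fin sqr_ge0.
set k := (a + b + e)%R; have k0 : (0 < k)%R by rewrite !addr_gt0.
have ka0 : (0 <= k / a)%R by rewrite divr_ge0// ltW.
have kb0 : (0 <= k / b)%R by rewrite divr_ge0// ltW.
have ke0 : (0 <= k * e)%R by rewrite mulr_ge0// ltW.
apply: (@le_trans _ _ (\int[W]_z ((k / a)%:E * u z + (k / b)%:E * v z + (k * e)%:E))).
  apply: ae_ge0_le_integral => //.
  - by move=> z _; rewrite lee_fin sqr_ge0.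
  - exact: (measurableT_comp msq mphi).
  - by move=> z _; rewrite !adde_ge0// mule_ge0.
  - apply: emeasurable_funD => //; apply: emeasurable_funD; exact: measurable_funeM.
  - case: WA => N [mN N0 NA]; exists N; split => // z /=; apply: contra_notP => zN _.
    have [i [Ai1 Ai2]] : exists i, A i z.1.2 /\ A i z.2.1.
      by apply: contrapT => h; apply: zN; exact: NA.
    rewrite -!EFinM -!EFinD lee_fin; apply: weighted_square => //; try exact: mdist_ge0.
    have := metric_triangle (z.1.1 : X) (z.1.2 : X) (z.2.2 : X).
    have := metric_triangle (z.1.2 : X) (z.2.1 : X) (z.2.2 : X).
    have := Ae i _ _ Ai1 Ai2; rewrite /phi/=; lra.
rewrite ge0_integralD//; last 2 first.
- by move=> z _; rewrite adde_ge0// mule_ge0.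
- by apply: emeasurable_funD => //; exact: measurable_funeM.
rewrite ge0_integralD//; last 4 first.
- by move=> z _; rewrite mule_ge0.
- exact: measurable_funeM.
- by move=> z _; rewrite mule_ge0.
- exact: measurable_funeM.
have intc : \int[W]__ (k * e)%:E = (k * e)%:E.
  rewrite integral_cst//; apply: etrans (mule1 _).
  by congr (_ * _); exact: probability_setT.
rewrite intc !ge0_integralZl_EFin// uE vE.
apply: (@le_trans _ _ ((k / a)%:E * (a ^+ 2)%:E + (k / b)%:E * (b ^+ 2)%:E + (k * e)%:E)).
  by rewrite leeD2r// leeD// lee_wpmul2l.
rewrite -!EFinM -!EFinD lee_fin le_eqVlt; apply/orP; left; apply/eqP.
by rewrite /k; field; rewrite !gt_eqF.
Qed.

Lemma W2_triangle (mu1 mu2 mu3 : probability (borel X) R) :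
  W2 mu1 mu3 <= W2 mu1 mu2 + W2 mu2 mu3.
Proof.
have := W2_ge0 mu1 mu2; have := W2_ge0 mu2 mu3.
case E1 : (W2 mu1 mu2) => [w1| |]; case E2 : (W2 mu2 mu3) => [w2| |]// w20 w10;
  rewrite ?addye ?addey ?leey//.
rewrite lee_fin in w10; rewrite lee_fin in w20.
apply/lee_addgt0Pr => e e0.
have e30 : (0 < e / 3)%R by rewrite divr_gt0.
have [P cP /ltW Pa] : exists2 pi, coupling mu1 mu2 pi & cost pi < ((w1 + e / 3) ^+ 2)%:E.
  by apply: W2_lt; [rewrite addr_ge0// ltW|rewrite E1 lte_fin ltrDl].
have [Q cQ /ltW Qb] : exists2 pi, coupling mu2 mu3 pi & cost pi < ((w2 + e / 3) ^+ 2)%:E.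
  by apply: W2_lt; [rewrite addr_ge0// ltW|rewrite E2 lte_fin ltrDl].
apply: (le_trans (W2_glue _ _ e30 cP cQ Pa Qb)).
- by rewrite ltr_wpDl.
- by rewrite ltr_wpDl.
- rewrite -!EFinD lee_fin; lra.
Qed.

End wasserstein_triangle.

Section wasserstein_dirac.
Context {R : realType} {X : completeMetricType R}.
Implicit Types (mu nu : probability (borel X) R).
Hypothesis sepX : @separable_space R X.
Local Open Scope ereal_scope.

Lemma measurable_closed (C : set X) : closed C -> measurable (C : set (borel X)).
Proof.
move=> cC; rewrite -[C]setCK; apply: measurableC; apply: measurable_open.
exact: closed_openC.
Qed.

Lemma closed_point (x : X) : closed [set x].
Proof. exact: (accessible_closed_set1 (hausdorff_accessible (@metric_hausdorff R X))). Qed.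

(** The only coupling with a Dirac mass is the product, so that the distance
    to it is a second moment. *)
Lemma W2_delta_sqr (x : X) (nu : probability (borel X) R) :
  W2 (delta x) nu ^+ 2 = \int[nu]_y (mdist x (y : X) ^+ 2)%:E.
Proof.
have mx : measurable_fun setT (fun y : borel X => (mdist x (y : X) ^+ 2)%:E).
  by apply/measurable_EFinP; apply: measurable_funX; exact: measurable_mdistl.
have costE pi : coupling (delta x) nu pi ->
    cost pi = \int[nu]_y (mdist x (y : X) ^+ 2)%:E.
  move=> cpi; rewrite (ge0_integral_image (P := pi) measurable_snd)//.
  - rewrite /cost; apply: ae_eq_integral => //.
    + exact: measurable_mdist_sq.
    + exact: (measurableT_comp mx measurable_snd).
    + have mC : measurable (~` [set x] : set (borel X)).
        by apply: measurableC; apply: measurable_closed; exact: closed_point.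
      exists (fst @^-1` (~` [set x])); split.
      * by rewrite -[Y in measurable Y]setTI; exact: measurable_fst.
      * apply: etrans (cpi _ mC).1 _; rewrite [LHS]diracE memNset//=; exact.
      * by move=> z /=; apply: contra_not => ->.
  - by move=> A mA; exact: esym (cpi A mA).2.
  - by move=> y; rewrite lee_fin sqr_ge0.
rewrite W2_sqr; apply/eqP; rewrite eq_le; apply/andP; split.
  have cprod : coupling (delta x) nu (delta x \x nu).
    move=> A mA; split.
      rewrite -setXT [LHS]product_measure1E//= probability_setT mule1//.
    by rewrite -setTX [LHS]product_measure1E//= probability_setT mul1e.
  by rewrite -(costE _ cprod); apply: ereal_inf_lbound; exists (delta x \x nu).
by apply: le_ereal_inf_tmp => _ [pi cpi <-]; rewrite costE.
Qed.

Lemma W2_delta (x y : X) : W2 (delta x) (delta y) = (mdist x y)%:E.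
Proof.
have := W2_delta_sqr x (delta y).
rewrite integral_dirac//; last first.
  by apply/measurable_EFinP; apply: measurable_funX; exact: measurable_mdistl.
rewrite diracT mul1e => h.
by rewrite -(gee0_abs (W2_ge0 _ _)) -sqrte_sqr h /= sqrtr_sqr ger0_norm ?mdist_ge0.
Qed.

Lemma P2_delta (x : X) : P2 (delta x).
Proof.
exists x; rewrite integral_dirac//; first by rewrite diracT mul1e ltry.
apply/measurable_EFinP; apply: measurable_funX.
rewrite (_ : (fun _ => _) = (fun y : borel X => mdist x (y : X))).
  exact: measurable_mdistl.
by apply/funext => y; rewrite metric_sym.
Qed.

(* The open neighbourhood of C of radius 1 / (n + 1). *)
Let thick (C : set X) (n : nat) : set X :=
  \bigcup_(x in C) [set y | (mdist x y < n.+1%:R^-1)%R].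

Let W2_0_thick mu nu C n : W2 mu nu = 0 -> measurable (C : set (borel X)) ->
  mu C <= nu (thick C n).
Proof.
move=> W0 mC; apply/lee_addgt0Pr => d d0.
set e : R := n.+1%:R^-1%R; have e0 : (0 < e)%R by rewrite invr_gt0.
have ot : open (thick C n) by apply: bigcup_open => x _; exact: mdist_ball_open.
have mt := measurable_open ot.
have s0 : (0 < Num.sqrt (e ^+ 2 * d))%R by rewrite sqrtr_gt0 mulr_gt0// exprn_gt0.
have [pi cpi] : exists2 pi, coupling mu nu pi & cost pi < (Num.sqrt (e ^+ 2 * d) ^+ 2)%:E.
  by apply: W2_lt; [exact: ltW|rewrite W0 lte_fin].
rewrite sqr_sqrtr; last by rewrite mulr_ge0 ?sqr_ge0// ltW.
move=> /ltW cpid.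
have [<- _] := cpi _ mC; have [_ <-] := cpi _ mt.
pose N : set (borel X * borel X) := [set z | (e <= mdist (z.1 : X) (z.2 : X))%R].
have mN : measurable N.
  rewrite (_ : N = setT `&` (fun z : borel X * borel X => mdist (z.1 : X) (z.2 : X)) @^-1` `[e, +oo[).
    exact: (measurable_mdist sepX).
  by rewrite setTI; apply/seteqP; split => z /=; rewrite in_itv/= andbT.
have m1 : measurable (fst @^-1` C : set (borel X * borel X)).
  by rewrite -[Y in measurable Y]setTI; exact: measurable_fst.
have m2 : measurable (snd @^-1` thick C n : set (borel X * borel X)).
  by rewrite -[Y in measurable Y]setTI; exact: measurable_snd.
apply: (@le_trans _ _ (pi ((snd @^-1` thick C n) `|` N))).
  apply: le_measure; rewrite ?inE//; first exact: measurableU.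
  move=> z /= Cz; have [h|h] := leP e (mdist (z.1 : X) (z.2 : X)); first by right.
  by left; exists z.1.
apply: (le_trans (measureU2 _ _ _)) => //; rewrite leeD2l//.
rewrite -(@lee_pmul2l _ (e ^+ 2)%:E) ?lte_fin ?exprn_gt0//.
apply: (le_trans _ (le_trans cpid _)); last by rewrite EFinM.
rewrite -integral_cst//; apply: (@le_trans _ _ (\int[pi]_(z in N) (mdist (z.1 : X) (z.2 : X) ^+ 2)%:E)).
  apply: ge0_le_integral => //.
  - by move=> z _; rewrite lee_fin sqr_ge0.
  - by apply: measurable_funTS; exact: measurable_mdist_sq.
  - by move=> z Nz; rewrite lee_fin ler_pXn2r// nnegrE ?mdist_ge0// ltW.
apply: ge0_subset_integral => //; first exact: measurable_mdist_sq.
by move=> z _; rewrite lee_fin sqr_ge0.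
Qed.

Let W2_0_closed mu nu C : W2 mu nu = 0 -> closed C -> mu C <= nu C.
Proof.
move=> W0 cC; have mC := measurable_closed cC.
have mt n : measurable (thick C n : set (borel X)).
  by apply: measurable_open; apply: bigcup_open => x _; exact: mdist_ball_open.
have tC : \bigcap_n thick C n = C.
  apply/seteqP; split => [y yt|y Cy n _]; last first.
    by exists y => //=; rewrite mdistxx invr_gt0.
  apply: contrapT => nCy.
  have [r r0 rC] := open_mdistP (closed_openC cC) nCy.
  have [n nr] : exists n : nat, (n.+1%:R^-1 < r)%R.
    exact: (@filter_ex _ _ _ _ (near_infty_natSinv_lt (PosNum r0))).
  have [x Cx /= xy] := yt n I.
  by apply: (rC x) => //=; rewrite metric_sym (lt_trans xy).
have cv : nu (thick C n) @[n --> \oo] --> nu (\bigcap_n thick C n).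
  apply: (nonincreasing_cvg_mu (mu := nu)) => //.
  - by rewrite -ge0_fin_numE ?fin_num_measure.
  - by apply: bigcap_measurable.
  - move=> m n mn; apply/subsetPset => y [x Cx /= xy]; exists x => //=.
    by rewrite (lt_le_trans xy)// lef_pV2 ?posrE// ler_nat.
rewrite tC in cv; rewrite -(cvg_lim _ cv)//; apply: lime_ge; first by apply: cvgP cv.
by apply: nearW => n; exact: W2_0_thick.
Qed.

(** If W2 vanishes, plans of small cost give mu C <= nu C for closed C, and
    closed sets determine a probability. *)
Lemma W2_eq0 mu nu : W2 mu nu = 0 -> measure_eq mu nu.
Proof.
move=> W0; have W0' : W2 nu mu = 0 by rewrite W2_sym.
have eqC C : closed C -> mu C = nu C.
  by move=> cC; apply/eqP; rewrite eq_le !W2_0_closed.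
have eqO U : open U -> mu U = nu U.
  move=> oU; have mC := measurableC (measurable_open oU).
  rewrite -[U]setCK [LHS]probability_setC// [RHS]probability_setC//.
  by congr (1 - _); exact: eqC (open_closedC oU).
apply: (g_sigma_algebra_measure_unique (T := borel X) (@open X) _ (fun _ => setT)) => //.
- by move=> U; exact: measurable_open.
- by move=> _; exact: openT.
- by rewrite bigcup_const.
- by move=> U V; exact: openI.
- by move=> _; rewrite -ge0_fin_numE ?fin_num_measure.
Qed.

End wasserstein_dirac.

(** * Lipschitz curves from approximate midpoints *)

Section length_space.
Context {R : realType} {X : completeMetricType R}.
Implicit Types (x y z : X).

Hypothesis midpoints : forall x y (e : R), 0 < e -> exists z,
  mdist x z <= mdist x y / 2 + e /\ mdist z y <= mdist x y / 2 + e.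

Let half (n : nat) : R := (2 ^+ n)^-1.

Let half_gt0 n : 0 < half n. Proof. by rewrite invr_gt0 exprn_gt0. Qed.

Let halfS n : half n.+1 = half n / 2.
Proof. by rewrite /half exprSr invfM mulrC. Qed.

Let half_small (e : R) : 0 < e -> exists n, half n < e.
Proof.
move=> e0; have [n ne] : exists n : nat, n.+1%:R^-1 < e.
  exact: (@filter_ex _ _ _ _ (near_infty_natSinv_lt (PosNum e0))).
exists n; apply: le_lt_trans ne; rewrite lef_pV2 ?posrE ?exprn_gt0//.
by rewrite -natrX ler_nat ltn_expl.
Qed.

Let truncn_double (t : R) : 0 <= t -> (Num.truncn (2 * t))./2 = Num.truncn t.
Proof.
move=> t0; symmetry; apply: truncn_def.
have /truncn_itv : 0 <= 2 * t by rewrite mulr_ge0.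
set k := Num.truncn (2 * t) => /andP[k1 k2].
have kE : k%:R = (odd k)%:R + 2 * (k./2)%:R :> R.
  by rewrite -[in LHS](odd_double_half k) natrD -muln2 natrM mulrC.
have : (odd k)%:R <= 1 :> R by rewrite -[1]/(1%:R) ler_nat; case: odd.
have : 0 <= (odd k)%:R :> R by [].
rewrite -natr1 in k2; rewrite -natr1; move: kE k1 k2; lra.
Qed.

Variables (x y : X) (e : R).
Hypothesis e0 : 0 < e.
Let len : R := mdist x y + e.
Let err (n : nat) : R := e * (half n.+1 * half n.+1).

Let mid_ex : exists mid : nat -> X -> X -> X, forall n a b,
  mdist a (mid n a b) <= mdist a b / 2 + err n /\
  mdist (mid n a b) b <= mdist a b / 2 + err n.
Proof.
have /choice[f fP] : forall u : nat * X * X, exists z,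
    mdist u.1.2 z <= mdist u.1.2 u.2 / 2 + err u.1.1 /\
    mdist z u.2 <= mdist u.1.2 u.2 / 2 + err u.1.1.
  by move=> [[n a] b]; apply: midpoints; rewrite mulr_gt0// mulr_gt0.
by exists (fun n a b => f (n, a, b)) => n a b; have := fP (n, a, b).
Qed.

(** In a complete space with approximate midpoints, any two points are joined
    by Lipschitz curves whose constant is arbitrarily close to the distance. *)
Lemma almost_shortest_curve : exists c : R -> X,
  [/\ c 0 = x, c 1 = y & forall s t, s \in `[0, 1] -> t \in `[0, 1] ->
    mdist (c s) (c t) <= (mdist x y + e) * `|s - t|].
Proof.
have [mid midP] := mid_ex.
have len0 : 0 < len by rewrite /len ltr_wpDl ?mdist_ge0.
pose fix g (n k : nat) {struct n} : X := if n is n'.+1 then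
    if odd k then mid n' (g n' k./2) (g n' k./2.+1) else g n' k./2
  else if k is 0 then x else y.
have err_half n v : v <= half n * (mdist x y + e * (1 - half n)) ->
    v / 2 + err n <= half n.+1 * (mdist x y + e * (1 - half n.+1)).
  by rewrite /err halfS; have := half_gt0 n; set w := half n; nra.
(* The errors err n are chosen so that this bound is preserved exactly. *)
have g_step' n k : mdist (g n k) (g n k.+1) <= half n * (mdist x y + e * (1 - half n)).
  elim: n k => [|n IHn] k.
    rewrite /half expr0 invr1 subrr mulr0 addr0 mul1r.
    by case: k => [//|k] /=; rewrite mdistxx mdist_ge0.
  apply: (le_trans _ (err_half _ _ (IHn k./2))); have [m1 m2] := midP n (g n k./2) (g n k./2.+1).
  by rewrite /= uphalf_half; have [ok|ok] := boolP (odd k).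
have half_len n : half n * (mdist x y + e * (1 - half n)) <= len * half n.
  by rewrite /len; have := half_gt0 n; set w := half n; have := e0; nra.
have g_step n k : mdist (g n k) (g n k.+1) <= len * half n.
  exact: (le_trans (g_step' n k)).
have g_lip n j k : (j <= k)%N -> mdist (g n j) (g n k) <= (k - j)%:R * (len * half n).
  move=> /subnKC <-; rewrite addKn; elim: (k - j)%N => [|i IHi].
    by rewrite addn0 mdistxx mul0r.
  rewrite addnS (le_trans (metric_triangle _ (g n (j + i)%N) _))//.
  by rewrite -natr1 mulrDl mul1r lerD.
pose u (s : R) n := g n (Num.truncn (2 ^+ n * s)).
have u_step s n : 0 <= s -> mdist (u s n) (u s n.+1) <= len * half n.+1.
  move=> s0; rewrite /u /= -/(g n) exprS -mulrA truncn_double ?mulr_ge0 ?exprn_ge0//.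
  set k := Num.truncn _; set k' := Num.truncn _.
  have [_|_] := boolP (odd k'); last by rewrite mdistxx mulr_ge0// ltW.
  have [m1 _] := midP n (g n k) (g n k.+1).
  by apply: (le_trans m1); apply: (le_trans (err_half _ _ (g_step' n k))).
have u_cauchy s n i : 0 <= s -> mdist (u s n) (u s (n + i)%N) <= len * (half n - half (n + i)%N).
  move=> s0; elim: i => [|i IHi]; first by rewrite addn0 mdistxx subrr mulr0.
  rewrite addnS (le_trans (metric_triangle _ (u s (n + i)%N) _))//.
  by have := u_step s (n + i)%N s0; rewrite halfS; move: IHi; lra.
have u_cvg s : 0 <= s -> cvg (u s @ \oo).
  move=> s0; apply: cauchy_cvg; apply/cauchyP => d d0.
  have [n nd] := half_small (divr_gt0 d0 len0).
  exists (u s n); exists n => // p /= np; rewrite ballEmdist/=.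
  rewrite -(subnKC np) (le_lt_trans (u_cauchy _ _ _ s0))//.
  rewrite -ltr_pdivlMl// mulrC (le_lt_trans _ nd)// gerBl ltW//.
pose c s := lim (u s @ \oo).
have uc s n : 0 <= s -> mdist (u s n) (c s) <= len * half n.
  move=> s0; apply/ler_addgt0Pr => d d0.
  have /metricType_numDomainType.cvgrPdist_lt/(_ d d0)[N _ Nd] := u_cvg s s0.
  have := Nd (n + N)%N (leq_addl _ _); rewrite -/(c s) metric_sym => h.
  rewrite (le_trans (metric_triangle _ (u s (n + N)%N) _))//.
  rewrite lerD ?(ltW h)// (le_trans (u_cauchy _ _ _ s0))// ler_pM2l// gerBl ltW//.
have ucst s z : (forall n, u s n = z) -> c s = z.
  move=> uz; rewrite /c (_ : u s = cst z); last exact/funext.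
  by apply: cvg_lim; [exact: metric_hausdorff|exact: cvg_cst].
exists c; split.
- apply: ucst => n; rewrite /u mulr0 truncn0; elim: n => //.
- apply: ucst => n; rewrite /u mulr1 -natrX natrK.
  elim: n => //= n IHn; rewrite expnS mul2n odd_double/= doubleK//.
- move=> s t; rewrite !in_itv/=.
  wlog st : s t / s <= t.
    move=> h s01 t01; have [|/ltW ts] := leP s t; first by move=> st; exact: h.
    by rewrite metric_sym distrC; exact: h.
  move=> /andP[s0 s1] /andP[t0 t1]; rewrite -/len.
  apply/ler_addgt0Pr => d d0.
  have [n nd] := half_small (divr_gt0 d0 (mulr_gt0 (ltr0n _ 3) len0)).
  have hs := uc s n s0; have ht := uc t n t0.
  have := metric_triangle (c s) (u s n) (c t).
  have := metric_triangle (u s n) (u t n) (c t).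
  rewrite (metric_sym (c s) (u s n)).
  have ut : mdist (u s n) (u t n) <= len * (t - s + half n).
    have n0 : 0 < 2 ^+ n :> R by rewrite exprn_gt0.
    have ts : 2 ^+ n * s <= 2 ^+ n * t by rewrite ler_pM2l.
    apply: (le_trans (g_lip _ _ _ (le_truncn ts))).
    rewrite natrB ?le_truncn//.
    have /truncn_itv/andP[_ k1] : 0 <= 2 ^+ n * s by rewrite mulr_ge0// ltW.
    have /truncn_itv/andP[k2 _] : 0 <= 2 ^+ n * t by rewrite mulr_ge0// ltW.
    have -> : len * (t - s + half n) = (2 ^+ n * t - 2 ^+ n * s + 1) * (len * half n).
      by rewrite /half; field; rewrite gt_eqF.
    rewrite ler_pM2r ?mulr_gt0//; rewrite -natr1 in k1; lra.
  rewrite ltr_pdivlMr ?mulr_gt0// in nd.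
  have -> : `|s - t| = t - s by rewrite distrC ger0_norm ?subr_ge0.
  lra.
Qed.

End length_space.

(** * Uniform measures on balls and their entropy *)

Section ball_measure.
Context {R : realType} {X : completeMetricType R}.
Variable m : {measure set (borel X) -> \bar R}.
Hypothesis sepX : @separable_space R X.
Hypothesis gaussX : gaussian_integrable m.
Hypothesis suppX : msupport m = [set: X].
Local Open Scope ereal_scope.

(** Open balls, as Borel sets. *)
Definition mball (x : X) (r : R) : set (borel X) := [set y : X | (mdist x y < r)%R].

Lemma measurable_mball x r : measurable (mball x r).
Proof. by apply: measurable_open; exact: mdist_ball_open. Qed.

Lemma mball_gt0 x r : (0 < r)%R -> 0 < m (mball x r).
Proof.
move=> r0; have : msupport m x by rewrite suppX.
apply; first exact: mdist_ball_open.
by rewrite /mball/= mdistxx.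
Qed.

Lemma mball_lty x r : m (mball x r) < +oo.
Proof.
have [C [x0 [C0 fin]]] := gaussX.
pose f (y : borel X) := expR (- C * mdist (y : X) x0 ^+ 2).
have mf : measurable_fun setT f.
  apply: measurableT_comp => //; apply: measurable_funM => //.
  apply: measurable_funX.
  rewrite (_ : (fun _ => _) = (fun y : borel X => mdist x0 (y : X))).
    exact: measurable_mdistl.
  by apply/funext => y; rewrite metric_sym.
pose k := expR (- C * (`|r| + mdist x x0) ^+ 2).
have k0 : (0 < k)%R by exact: expR_gt0.
have : k%:E * m (mball x r) < +oo.
  apply: le_lt_trans fin; rewrite -integral_cst; last exact: measurable_mball.
  apply: (@le_trans _ _ (\int[m]_(y in mball x r) (f y)%:E)).
    apply: ge0_le_integral => //.
    - exact: measurable_mball.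
    - by move=> y _; rewrite lee_fin ltW.
    - by apply/measurable_EFinP; exact: measurable_funTS.
    - move=> y xy; rewrite lee_fin ler_expR !mulNr lerN2 ler_pM2l//.
      rewrite ler_pXn2r ?nnegrE ?mdist_ge0 ?addr_ge0 ?mdist_ge0//.
      have := metric_triangle (y : X) x x0; have := ler_norm r.
      by rewrite (metric_sym (y : X) x); rewrite /mball/= in xy; lra.
  apply: ge0_subset_integral => //; first exact: measurable_mball.
  - exact/measurable_EFinP.
  - by move=> y _; rewrite lee_fin expR_ge0.
case E : (m (mball x r)) => [w| |]; rewrite ?ltry//.
by rewrite gt0_muley ?lte_fin.
Qed.

Lemma density_unique (mu : probability (borel X) R) (rho rho' : borel X -> R) :
  density m mu rho -> density m mu rho' -> {ae m, forall y, rho y = rho' y}.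
Proof.
move=> [mr r0 rE] [mr' r0' rE'].
have ri : m.-integrable setT (EFin \o rho).
  apply/integrableP; split; first exact/measurable_EFinP.
  under eq_integral do rewrite /= ger0_norm//.
  by rewrite -rE// probability_setT ltry.
have : ae_eq m setT (EFin \o rho) (EFin \o rho').
  apply: integral_ae_eq => //; first exact/measurable_EFinP.
  by move=> E _ mE; rewrite -rE// -rE'.
by apply: filterS => y /= /(_ I) [].
Qed.

(** The entropy may be computed with any density. *)
Lemma EntE (mu : probability (borel X) R) (rho : borel X -> R) : density m mu rho ->
  Ent m mu = \int[m]_y (rho y * ln (rho y))%:E.
Proof.
move=> drho; rewrite /Ent (_ : [set _ | _ in _] = [set \int[m]_y (rho y * ln (rho y))%:E]).
  by rewrite ereal_inf1.
apply/seteqP; split => [_ [rho' drho' <-]|_ ->]; last by exists rho.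
apply: ae_eq_integral_all.
by have := density_unique drho' drho; apply: filterS => y -> _.
Qed.

(** The uniform probability on a ball has finite entropy, and is close to the
    Dirac mass at the centre. *)
Lemma ball_probability x r : (0 < r)%R -> exists mu : probability (borel X) R,
  Ent_dom m mu /\ W2 (delta x) mu <= r%:E.
Proof.
move=> r0; have mB := measurable_mball x r.
have B0 := mball_gt0 x r0; have Boo := mball_lty x r.
pose w := fine (m (mball x r)).
have wE : m (mball x r) = w%:E by rewrite /w fineK// ge0_fin_numE.
have w0 : (0 < w)%R by rewrite -lte_fin -wE.
have [mu muE] : exists mu : probability (borel X) R,
    forall A, mu A = m (A `&` mball x r) * (w^-1)%:E.
  have [n nE] : exists n : {measure set (borel X) -> \bar R},
      forall A, n A = m (A `&` mball x r) by exists (mrestr m mB).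
  have nT : n setT = w%:E by rewrite nE setTI.
  exists (mnormalize n (delta x)) => A.
  rewrite /= /mnormalize nT -nE.
  by rewrite eqe gt_eqF//=.
exists mu.
pose rho (y : borel X) : R := (w^-1 * \1_(mball x r) y)%R.
have mrho : measurable_fun setT rho by exact: measurable_funM.
have drho : density m mu rho.
  split => //; first by move=> y; rewrite mulr_ge0// invr_ge0 ltW.
  move=> A mA; rewrite muE.
  under eq_integral do rewrite /rho EFinM.
  rewrite ge0_integralZl_EFin//; last 2 first.
  - by apply/measurable_EFinP; exact: measurable_indic.
  - by rewrite invr_ge0 ltW.
  by rewrite integral_indic// (setIC (mball x r)) muleC.
have muN : mu (~` mball x r) = 0 by rewrite muE setICl measure0 mul0e.
have second : \int[mu]_y (mdist x (y : X) ^+ 2)%:E <= (r ^+ 2)%:E.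
  apply: (@le_trans _ _ (\int[mu]_y (r ^+ 2)%:E)).
    apply: ae_ge0_le_integral => //.
    - by move=> y _; rewrite lee_fin sqr_ge0.
    - by apply/measurable_EFinP; apply: measurable_funX; exact: measurable_mdistl.
    - by move=> y _; rewrite lee_fin sqr_ge0.
    - exists (~` mball x r); split => //; first exact: measurableC.
      move=> y /=; apply: contra_not => xy _.
      by rewrite lee_fin ler_pXn2r ?nnegrE ?mdist_ge0// ltW.
  rewrite integral_cst//= -[leRHS]mule1 lee_wpmul2l ?lee_fin ?sqr_ge0//.
  by rewrite -(probability_setT mu).
split; last first.
  rewrite -(@lee_sqr _ _ r%:E) ?W2_ge0 ?lee_fin ?(ltW r0)//.
  by rewrite (W2_delta_sqr sepX) -EFin_expe.
split.
  exists x; rewrite (eq_integral (fun y : borel X => (mdist x (y : X) ^+ 2)%:E)).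
    by rewrite (le_lt_trans second)// ltry.
  by move=> y _; rewrite metric_sym.
rewrite (EntE drho) (_ : (fun y => _) =
    (fun y => (w^-1 * ln w^-1)%:E * (\1_(mball x r) y)%:E)).
  apply: integrable_fin_num => //; apply: integrableZl => //.
  apply/integrableP; split; first by apply/measurable_EFinP; exact: measurable_indic.
  under eq_integral do rewrite /= ger0_norm//.
  by rewrite integral_indic// setIT.
apply/funext => y; rewrite /rho indicE; case: (y \in _) => /=.
  by rewrite !mulr1 mule1.
by rewrite mulr0 mul0r mule0.
Qed.

End ball_measure.

(** * The length distance of a pseudo-distance *)

Section intrinsic_distance.
Context {R : realType} {X : completeMetricType R}.
Variables (D : X -> X -> \bar R) (k : R).
Hypothesis k0 : 0 < k.
Hypothesis Ddist : pseudo_distance D.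
Hypothesis Dk : forall x y, (D x y <= (k * mdist x y)%:E)%E.
Hypothesis curves : forall (x y : X) (e : R), 0 < e -> exists c : R -> X,
  [/\ c 0 = x, c 1 = y & forall s t, s \in `[0, 1] -> t \in `[0, 1] ->
    mdist (c s) (c t) <= (mdist x y + e) * `|s - t|].
Local Open Scope ereal_scope.

(** The length of a curve on [0, 1]. *)
Definition curve_length (c : R -> X) : \bar R :=
  \int[lebesgue_measure]_(s in `[0%R, 1%R]) metric_speed D c s.

(** The length distance associated with D, over Lipschitz curves. *)
Definition intrinsic (x y : X) : \bar R :=
  ereal_inf [set curve_length c
    | c in [set c : R -> X | [/\ lipschitz_curve c, c 0%R = x & c 1%R = y]]].

Let lip_pos (c : R -> X) : lipschitz_curve c -> exists L : R, (0 < L)%R /\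
  forall s t, s \in `[0%R, 1%R] -> t \in `[0%R, 1%R] ->
    (mdist (c s) (c t) <= L * `|s - t|)%R.
Proof.
move=> [L cL]; exists (`|L| + 1)%R; split; first by rewrite ltr_wpDl.
move=> s t s01 t01; apply: (le_trans (cL s t s01 t01)).
by rewrite ler_wpM2r// (le_trans (ler_norm L))// lerDl.
Qed.

Let lipD (c : R -> X) (L : R) :
  (forall s t, s \in `[0%R, 1%R] -> t \in `[0%R, 1%R] ->
    (mdist (c s) (c t) <= L * `|s - t|)%R) ->
  forall s t, s \in `[0%R, 1%R] -> t \in `[0%R, 1%R] ->
    D (c s) (c t) <= (k * L * `|s - t|)%:E.
Proof.
move=> cL s t s01 t01; apply: (le_trans (Dk _ _)).
by rewrite lee_fin -mulrA ler_pM2l// cL.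
Qed.

Let lipschitz_concat (c1 c2 : R -> X) : lipschitz_curve c1 -> lipschitz_curve c2 ->
  c1 1%R = c2 0%R ->
  lipschitz_curve (fun s => if (s <= 2^-1)%R then c1 (2 * s)%R else c2 (2 * s - 1)%R).
Proof.
move=> /lip_pos[L1 [L10 cL1]] /lip_pos[L2 [L20 cL2]] c12.
exists (2 * L1 + 2 * L2)%R => s t; wlog st : s t / (s <= t)%R.
  move=> h s01 t01; have [|/ltW ts] := leP s t; first by move=> st; exact: h.
  by rewrite metric_sym distrC; exact: h.
rewrite !in_itv/= => /andP[s0 s1] /andP[t0 t1].
have -> : (`|s - t| = t - s)%R by rewrite distrC ger0_norm ?subr_ge0.
have low u v : (0 <= u)%R -> (u <= v)%R -> (v <= 2^-1)%R ->
    (mdist (c1 (2 * u)%R) (c1 (2 * v)%R) <= 2 * L1 * (v - u))%R.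
  move=> u0 uv v1; have := cL1 (2 * u)%R (2 * v)%R.
  rewrite !in_itv/= distrC -mulrBr ger0_norm; last by rewrite mulr_ge0// subr_ge0.
  by rewrite mulrCA mulrA; apply; lra.
have high u v : (2^-1 <= u)%R -> (u <= v)%R -> (v <= 1)%R ->
    (mdist (c2 (2 * u - 1)%R) (c2 (2 * v - 1)%R) <= 2 * L2 * (v - u))%R.
  move=> u0 uv v1; have := cL2 (2 * u - 1)%R (2 * v - 1)%R.
  rewrite !in_itv/= distrC (_ : (2 * v - 1 - (2 * u - 1) = 2 * (v - u))%R); last ring.
  rewrite ger0_norm; last by rewrite mulr_ge0// subr_ge0.
  by rewrite mulrCA mulrA; apply; lra.
case: ifPn => sh; case: ifPn => th; rewrite -?ltNge in sh th.
- apply: (le_trans (low _ _ s0 st th)); rewrite ler_wpM2r ?subr_ge0//.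
  by rewrite lerDl mulr_ge0// ltW.
- apply: (le_trans (metric_triangle _ (c1 1%R) _)); rewrite {2}c12.
  have := low s 2^-1%R s0 sh (lexx _); have := high 2^-1%R t (lexx _) (ltW th) t1.
  rewrite mulfV// subrr; nra.
- by lra.
- apply: (le_trans (high _ _ (ltW sh) st t1)); rewrite ler_wpM2r ?subr_ge0//.
  by rewrite lerDr mulr_ge0// ltW.
Qed.

Let primitive (c : R -> X) : lipschitz_curve c -> exists M : R -> R,
  [/\ exists2 L : R, (0 < L)%R & forall s t, (`|M s - M t| <= L * `|s - t|)%R,
    forall s t : R, (0 <= s)%R -> (s <= t)%R -> (t <= 1)%R ->
      D (c s) (c t) <= (M t - M s)%:E &
    curve_length c = (M 1 - M 0)%:E].
Proof.
move=> /lip_pos[L [L0 cL]]; have kL : (0 < k * L)%R by rewrite mulr_gt0.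
have [M [ML MD Mlen]] := length_primitive Ddist kL (lipD cL).
by exists M; split => //; exists (k * L)%R.
Qed.

Let curve_length_le (c : R -> X) (V : R -> R) (L : R) : lipschitz_curve c ->
  (0 < L)%R -> (forall s t, (`|V s - V t| <= L * `|s - t|)%R) ->
  (forall s t : R, (0 <= s)%R -> (s <= t)%R -> (t <= 1)%R ->
      D (c s) (c t) <= (V t - V s)%:E) ->
  curve_length c <= (V 1 - V 0)%:E.
Proof.
move=> /lip_pos[L' [L'0 cL]] L0 VL VD; have kL : (0 < k * L')%R by rewrite mulr_gt0.
exact: (length_le Ddist kL (lipD cL) L0 VL VD).
Qed.

Lemma intrinsic_ge x y : D x y <= intrinsic x y.
Proof.
apply: le_ereal_inf_tmp => _ [c [/primitive[M [_ MD ->]] <- <-] <-].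
exact: MD.
Qed.

Lemma intrinsic_le x y : intrinsic x y <= (k * mdist x y)%:E.
Proof.
apply/lee_addgt0Pr => e e0; have ek0 : (0 < e / k)%R by rewrite divr_gt0.
have [c [c0 c1 cL]] := curves x y ek0.
have clip : lipschitz_curve c by exists (mdist x y + e / k)%R.
apply: (@le_trans _ _ (curve_length c)).
  by apply: ereal_inf_lbound; exists c.
(* The linear function of slope L bounds the length. *)
pose L : R := (k * (mdist x y + e / k))%R.
have L0 : (0 < L)%R by rewrite mulr_gt0// ltr_wpDl// mdist_ge0.
have LE : L = (k * mdist x y + e)%R by rewrite /L; field; rewrite gt_eqF.
have := @curve_length_le c (fun s => L * s)%R L clip L0.
rewrite mulr1 mulr0 subr0 -EFinD -LE; apply.
  by move=> s t; rewrite -mulrBr normrM gtr0_norm.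
move=> s t s0 st t1; rewrite -mulrBr.
have -> : (t - s = `|s - t|)%R by rewrite distrC ger0_norm// subr_ge0.
by apply: lipD => //; rewrite in_itv/= ?s0 ?t1 ?(le_trans st t1) ?(le_trans s0 st).
Qed.

Lemma intrinsic_fin_num x y : intrinsic x y \is a fin_num.
Proof.
rewrite ge0_fin_numE; first by rewrite (le_lt_trans (intrinsic_le x y))// ltry.
apply: le_trans (intrinsic_ge x y); by case: Ddist => /(_ x y)[].
Qed.

Let intrinsic_sym_le x y : intrinsic y x <= intrinsic x y.
Proof.
have [_ _ Dsym _] := Ddist.
have rev s t : (`|1 - s - (1 - t)| = `|s - t| :> R)%R.
  by rewrite (_ : 1 - s - (1 - t) = t - s)%R; [exact: distrC|ring].
apply: le_ereal_inf_tmp => _ [c [cl c0 c1] <-].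
have cl' : lipschitz_curve (fun s => c (1 - s)%R).
  case: cl => L cL; exists L => s t; rewrite !in_itv/= => s01 t01.
  by rewrite -rev; apply: cL; rewrite in_itv/=; lra.
apply: (@le_trans _ _ (curve_length (fun s => c (1 - s)%R))).
  apply: ereal_inf_lbound; exists (fun s => c (1 - s)%R) => //.
  by split; rewrite ?subrr ?subr0.
have [M [[L L0 ML] MD ->]] := primitive cl.
have := @curve_length_le _ (fun s => - M (1 - s))%R L cl' L0.
rewrite subrr subr0 opprK (addrC (- M 0%R)%R); apply.
  by move=> s t; rewrite -opprD normrN (le_trans (ML _ _))// rev.
move=> s t s0 st t1; rewrite Dsym opprK (addrC (- M _)%R); apply: MD; lra.
Qed.

Lemma intrinsic_triangle x y z : intrinsic x z <= intrinsic x y + intrinsic y z.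
Proof.
apply/lee_addgt0Pr => e e0; have e20 : (0 < e / 2)%R by rewrite divr_gt0.
have [_ [c1 [cl1 c10 c11] <-] len1] : exists2 l, [set curve_length c
    | c in [set c : R -> X | [/\ lipschitz_curve c, c 0%R = x & c 1%R = y]]] l &
    l < intrinsic x y + (e / 2)%:E.
  by apply: ereal_inf_lt; rewrite lteDl ?intrinsic_fin_num.
have [_ [c2 [cl2 c20 c21] <-] len2] : exists2 l, [set curve_length c
    | c in [set c : R -> X | [/\ lipschitz_curve c, c 0%R = y & c 1%R = z]]] l &
    l < intrinsic y z + (e / 2)%:E.
  by apply: ereal_inf_lt; rewrite lteDl ?intrinsic_fin_num.
(* The curves are run through twice as fast one after the other, and V is the
   concatenation of their length functions. *)
have [M1 [[L1 L10 ML1] MD1 lenE1]] := primitive cl1.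
have [M2 [[L2 L20 ML2] MD2 lenE2]] := primitive cl2.
pose c (s : R) := if (s <= 2^-1)%R then c1 (2 * s)%R else c2 (2 * s - 1)%R.
have chalf : c1 1%R = c2 0%R by rewrite c11 c20.
have cl : lipschitz_curve c by exact: lipschitz_concat.
pose V s := (M1 (clamp (2 * s)) + M2 (clamp (2 * s - 1)))%R.
have VL s t : (`|V s - V t| <= (2 * L1 + 2 * L2) * `|s - t|)%R.
  have := clamp_lipschitz (2 * s)%R (2 * t)%R.
  have := clamp_lipschitz (2 * s - 1)%R (2 * t - 1)%R.
  rewrite opprB addrA subrK -mulrBr normrM (ger0_norm (ler0n _ 2)) => h2 h1.
  have v1 : (`|M1 (clamp (2 * s)) - M1 (clamp (2 * t))| <= L1 * (2 * `|s - t|))%R.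
    by rewrite (le_trans (ML1 _ _))// ler_pM2l.
  have v2 : (`|M2 (clamp (2 * s - 1)) - M2 (clamp (2 * t - 1))| <= L2 * (2 * `|s - t|))%R.
    by rewrite (le_trans (ML2 _ _))// ler_pM2l.
  rewrite (_ : V s - V t = (M1 (clamp (2 * s)) - M1 (clamp (2 * t))) +
    (M2 (clamp (2 * s - 1)) - M2 (clamp (2 * t - 1))))%R; last by rewrite /V; ring.
  by rewrite (le_trans (ler_normD _ _))//; move: v1 v2; lra.
have Vlow s : (0 <= s)%R -> (s <= 2^-1)%R -> V s = (M1 (2 * s) + M2 0)%R.
  move=> s0 s1; rewrite /V clamp_id; last lra.
  by rewrite /clamp (min_idPr _) ?(max_idPl _)//; lra.
have Vhigh s : (2^-1 <= s)%R -> (s <= 1)%R -> V s = (M1 1 + M2 (2 * s - 1))%R.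
  move=> s0 s1; rewrite /V (clamp_id (s := (2 * s - 1)%R)); last lra.
  by rewrite /clamp (min_idPl _) ?(max_idPr _)//; lra.
have c_high s : (2^-1 <= s)%R -> c s = c2 (2 * s - 1)%R.
  move=> hs; rewrite /c; case: ifPn => // sh.
  have -> : s = 2^-1%R by apply/eqP; rewrite eq_le hs sh.
  by rewrite mulfV// chalf subrr.
have c_low s : (s <= 2^-1)%R -> c s = c1 (2 * s)%R by rewrite /c => ->.
have VDlow s t : (0 <= s)%R -> (s <= t)%R -> (t <= 2^-1)%R ->
    D (c s) (c t) <= (V t - V s)%:E.
  move=> s0 st t1; have s1 := le_trans st t1; have t0 := le_trans s0 st.
  rewrite (_ : V t - V s = M1 (2 * t) - M1 (2 * s))%R; last by rewrite !Vlow//; ring.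
  by rewrite !c_low//; apply: MD1; lra.
have VDhigh s t : (2^-1 <= s)%R -> (s <= t)%R -> (t <= 1)%R ->
    D (c s) (c t) <= (V t - V s)%:E.
  move=> s0 st t1; have s1 := le_trans st t1; have t0 := le_trans s0 st.
  rewrite (_ : V t - V s = M2 (2 * t - 1) - M2 (2 * s - 1))%R; last by rewrite !Vhigh//; ring.
  by rewrite !c_high//; apply: MD2; lra.
have VD s t : (0 <= s)%R -> (s <= t)%R -> (t <= 1)%R -> D (c s) (c t) <= (V t - V s)%:E.
  move=> s0 st t1; have [th|/ltW ht] := leP t 2^-1%R; first exact: VDlow.
  have [hs|/ltW sh] := leP 2^-1%R s; first exact: VDhigh.
  have [_ _ _ Dtri] := Ddist; apply: (le_trans (Dtri _ (c 2^-1%R) _)).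
  rewrite (_ : V t - V s = (V 2^-1 - V s) + (V t - V 2^-1))%R; last ring.
  by rewrite EFinD; apply: leeD; [exact: VDlow|exact: VDhigh].
apply: (@le_trans _ _ (curve_length c)).
  apply: ereal_inf_lbound; exists c => //; split => //.
    by rewrite c_low ?mulr0// invr_ge0.
  by rewrite c_high; [rewrite (_ : (2 * 1 - 1)%R = 1%R)//; ring|lra].
have VL0 : (0 < 2 * L1 + 2 * L2)%R by rewrite addr_gt0// mulr_gt0.
apply: (le_trans (curve_length_le cl VL0 VL VD)).
rewrite Vhigh; [|lra..]; rewrite Vlow; [|lra..].
move: len1 len2; rewrite lenE1 lenE2.
rewrite -(fineK (intrinsic_fin_num x y)) -(fineK (intrinsic_fin_num y z)).
rewrite -!EFinD !lte_fin lee_fin mulr0 (_ : (2 * 1 - 1)%R = 1%R); last ring.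
lra.
Qed.

Lemma intrinsic_pseudo_distance : pseudo_distance intrinsic.
Proof.
have [D1 _ _ _] := Ddist.
have ge0 x y : 0 <= intrinsic x y.
  by apply: le_trans (intrinsic_ge x y); case: (D1 x y).
split.
- by move=> x y; split; [exact: intrinsic_fin_num|exact: ge0].
- move=> x; apply/eqP; rewrite eq_le ge0 andbT.
  by rewrite (le_trans (intrinsic_le x x))// mdistxx mulr0.
- by move=> x y; apply/eqP; rewrite eq_le !intrinsic_sym_le.
- exact: intrinsic_triangle.
Qed.

End intrinsic_distance.

(** * Approximate midpoints from the curvature condition *)

Section approximate_midpoints.
Context {R : realType} {X : completeMetricType R}.
Variables (m : {measure set (borel X) -> \bar R}) (K : R).
Hypothesis sepX : @separable_space R X.
Hypothesis gaussX : gaussian_integrable m.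
Hypothesis suppX : msupport m = [set: X].

(** A W2-midpoint of uniform measures on two small balls is close to a W2-midpoint
    of the Dirac masses at the centres, and any point of small total cost is an
    approximate midpoint of the centres. *)
Lemma CD_midpoint (x y : X) (e : R) : CD K m -> 0 < e -> exists z,
  mdist x z <= mdist x y / 2 + e /\ mdist z y <= mdist x y / 2 + e.
Proof.
move=> cd e0; set d := mdist x y; have d0 : 0 <= d by exact: mdist_ge0.
(* So chosen that 2 * (d / 2 + 2 * r) ^+ 2 + r <= d ^+ 2 / 2 + e ^+ 2. *)
pose r := Num.min 1 (e ^+ 2 / (4 * d + 9)).
have de0 : 0 < 4 * d + 9 by lra.
have r0 : 0 < r by rewrite lt_min ltr01 divr_gt0// exprn_gt0.
have r1 : r <= 1 by rewrite ge_min lexx.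
have re : r * (4 * d + 9) <= e ^+ 2 by rewrite -ler_pdivlMr// ge_min lexx orbT.
have [mu [Emu xmu]] := ball_probability sepX gaussX suppX x r0.
have [nu [Enu ynu]] := ball_probability sepX gaussX suppX y r0.
have [c [_ c0 c1 cW] _] := cd mu nu Emu Enu.
have half01 : 2^-1 \in `[0:R, 1] by rewrite in_itv/=; lra.
have i0 : 0 \in `[0:R, 1] by rewrite in_itv/= lexx ler01.
have i1 : 1 \in `[0:R, 1] by rewrite in_itv/= lexx ler01.
pose s := c 2^-1; pose l := d / 2 + 2 * r.
have mn : (W2 mu nu <= (d + 2 * r)%:E)%E.
  apply: (le_trans (W2_triangle sepX mu (delta x) nu)).
  apply: (@le_trans _ _ (r%:E + (d%:E + r%:E))%E); last by rewrite -!EFinD lee_fin; lra.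
  apply: leeD; first by rewrite (W2_sym sepX).
  apply: (le_trans (W2_triangle sepX (delta x) (delta y) nu)).
  by apply: leeD => //; rewrite (W2_delta sepX).
have half_mn : (2^-1%:E * W2 mu nu <= (d / 2 + r)%:E)%E.
  apply: (@le_trans _ _ (2^-1%:E * (d + 2 * r)%:E)%E); first exact: lee_wpmul2l.
  by rewrite -EFinM lee_fin; lra.
have hx : (W2 (delta x) s <= l%:E)%E.
  apply: (le_trans (W2_triangle sepX (delta x) mu s)).
  apply: (@le_trans _ _ (r%:E + (d / 2 + r)%:E)%E); last by rewrite -EFinD lee_fin /l; lra.
  apply: leeD => //; have := cW 0 2^-1 i0 half01.
  rewrite sub0r normrN ger0_norm// (W2_eq (mu' := mu) (nu' := s))// => ->.
  exact: half_mn.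
have hy : (W2 (delta y) s <= l%:E)%E.
  apply: (le_trans (W2_triangle sepX (delta y) nu s)).
  apply: (@le_trans _ _ (r%:E + (d / 2 + r)%:E)%E); last by rewrite -EFinD lee_fin /l; lra.
  apply: leeD => //; have := cW 1 2^-1 i1 half01.
  rewrite (_ : `|1 - 2^-1| = 2^-1 :> R); last first.
    by rewrite ger0_norm; lra.
  rewrite (W2_eq (mu' := nu) (nu' := s))// => ->.
  exact: half_mn.
have l0 : 0 <= l by rewrite /l; lra.
have sq z : (W2 (delta z) s <= l%:E)%E ->
    (\int[s]_y (mdist z (y : X) ^+ 2)%:E <= (l ^+ 2)%:E)%E.
  by move=> h; rewrite -(W2_delta_sqr sepX) EFin_expe lee_sqr ?W2_ge0 ?lee_fin.
have [z hz] : exists z, mdist x z ^+ 2 + mdist y z ^+ 2 <= 2 * l ^+ 2 + r.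
  apply: contrapT => /forallNP h.
  have mz (w : X) : measurable_fun setT (fun y : borel X => (mdist w (y : X) ^+ 2)%:E).
    by apply/measurable_EFinP; apply: measurable_funX; exact: measurable_mdistl.
  have : (\int[s]_z (2 * l ^+ 2 + r)%:E <=
      \int[s]_z ((mdist x (z : X) ^+ 2)%:E + (mdist y (z : X) ^+ 2)%:E))%E.
    apply: ge0_le_integral => //.
    - by move=> z _; rewrite lee_fin addr_ge0 ?mulr_ge0 ?sqr_ge0// ltW.
    - exact: emeasurable_funD.
    - by move=> z _; rewrite -EFinD lee_fin leNgt; apply/negP => /ltW; exact: h.
  rewrite integral_cst//= ge0_integralD//; last 2 first.
  - by move=> z _; rewrite lee_fin sqr_ge0.
  - by move=> z _; rewrite lee_fin sqr_ge0.
  rewrite (_ : s setT = 1%E) ?mule1; last exact: probability_setT.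
  apply/negP; rewrite -ltNge.
  apply: (@le_lt_trans _ _ ((l ^+ 2)%:E + (l ^+ 2)%:E)%E).
    by apply: leeD; exact: sq.
  by rewrite -EFinD lte_fin; lra.
have tri := metric_triangle x z y.
exists z; rewrite (metric_sym z y); rewrite (metric_sym z y) -/d in tri.
move: hz tri; rewrite /l; set a := mdist x z; set b := mdist y z => hz tri.
(* This uses d <= a + b. *)
have ab : (a - d / 2) ^+ 2 + (b - d / 2) ^+ 2 <= e ^+ 2 by nra.
split; rewrite -lerBlDl.
  have : `|a - d / 2| <= `|e|.
    by rewrite -ler_sqr ?nnegrE// !real_normK ?num_real//; have := sqr_ge0 (b - d / 2); lra.
  by rewrite (ger0_norm (ltW e0)); apply: le_trans; exact: ler_norm.
have : `|b - d / 2| <= `|e|.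
  by rewrite -ler_sqr ?nnegrE// !real_normK ?num_real//; have := sqr_ge0 (a - d / 2); lra.
by rewrite (ger0_norm (ltW e0)); apply: le_trans; exact: ler_norm.
Qed.

End approximate_midpoints.

(** * The distances associated with the heat flow *)

Section heat_flow_distances.
Context {R : realType} {X : completeMetricType R}.
Variables (m : {measure set (borel X) -> \bar R}) (K : R).
Variable H : R -> probability (borel X) R -> probability (borel X) R.
Hypothesis sepX : @separable_space R X.
Hypothesis gaussX : gaussian_integrable m.
Hypothesis suppX : msupport m = [set: X].
Hypothesis hH : heat_flow K m H.

Lemma dtilde_le (t : R) (x y : X) : 0 <= t ->
  (dtilde H t x y <= (expR (- K * t) * mdist x y)%:E)%E.
Proof.
move=> t0; have [_ contr _ _] := hH; rewrite EFinM -(W2_delta sepX).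
by apply: contr => //; exact: P2_delta.
Qed.

(** H 0 fixes the measures of finite entropy, which approximate the Dirac
    masses, and it is a contraction. *)
Lemma heat_flow0_delta (x : X) : measure_eq (H 0 (delta x)) (delta x).
Proof.
have [_ contr _ grad] := hH.
apply: (W2_eq0 sepX); apply/eqP; rewrite eq_le W2_ge0 andbT.
apply/lee_addgt0Pr => e e0; have r0 : 0 < e / 2 by rewrite divr_gt0.
have [mu [Emu xmu]] := ball_probability sepX gaussX suppX x r0.
have [P2mu _] := Emu; have [_ _ Hmu _] := grad mu Emu.
apply: (le_trans (W2_triangle sepX _ (H 0 mu) _)).
rewrite add0e (splitr e) EFinD; apply: leeD.
  apply: (le_trans (contr 0 _ _ (lexx 0) (P2_delta x) P2mu)).
  by rewrite mulr0 expR0 mul1e.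
by rewrite (W2_eq (mu' := mu) (nu' := delta x))// (W2_sym sepX).
Qed.

Lemma dtilde0 (x y : X) : dtilde H 0 x y = (mdist x y)%:E.
Proof.
rewrite /dtilde -(W2_delta sepX).
by apply: W2_eq; exact: heat_flow0_delta.
Qed.

Lemma dtilde_pseudo_distance (t : R) : 0 <= t -> pseudo_distance (dtilde H t).
Proof.
move=> t0; split.
- move=> x y; split; last exact: W2_ge0.
  by rewrite ge0_fin_numE ?W2_ge0// (le_lt_trans (dtilde_le x y t0))// ltry.
- by move=> x; exact: (W2_refl sepX).
- by move=> x y; exact: (W2_sym sepX).
- by move=> x y z; exact: (W2_triangle sepX).
Qed.

Lemma dtilde_separates (t : R) : 0 < t -> injective_on_P2 (H t) ->
  forall x y : X, dtilde H t x y = 0 -> x = y.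
Proof.
move=> t0 inj x y /(W2_eq0 sepX) /(inj _ _ (P2_delta x) (P2_delta y)).
move=> /(_ [set x] (measurable_closed (@closed_point _ _ x))).
rewrite /delta/= !diracE mem_set//; have [/set_mem//|_] := boolP (y \in [set x]).
by move=> [] /eqP; rewrite oner_eq0.
Qed.

End heat_flow_distances.

Section compact_topology.
Context {R : realType} {X : completeMetricType R}.
Variables (D E : X -> X -> \bar R) (k : R).
Hypothesis k0 : 0 < k.
Hypothesis Ddist : distance D.
Hypothesis DE : forall x y, (D x y <= E x y)%E.
Hypothesis Ek : forall x y, (E x y <= (k * mdist x y)%:E)%E.

Let rd x y := fine (D x y).
Let rdE x y : D x y = (rd x y)%:E.
Proof. by case: Ddist => -[/(_ x y)[? _] _ _ _] _; rewrite /rd fineK. Qed.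

Let rd_continuous x : continuous (rd x).
Proof.
have [[_ _ Dsym Dtri] _] := Ddist.
move=> y; apply/cvgrPdist_le => e e0.
have : \forall z \near y, mdist y z < e / k.
  apply/metricType_numDomainType.nbhs_mdistP; exists (e / k) => //=.
  by rewrite divr_gt0.
apply: filterS => z; rewrite ltr_pdivlMr// mulrC => yz.
have kyz : rd y z <= k * mdist y z by rewrite -lee_fin -rdE (le_trans (DE _ _)).
have t1 := Dtri x y z; have t2 := Dtri x z y; rewrite (Dsym z y) in t2.
rewrite !rdE -EFinD lee_fin in t1; rewrite !rdE -EFinD lee_fin in t2.
by rewrite ler_norml; lra.
Qed.

(** On a compact space, a distance dominated by a multiple of the given one
    induces its topology, and so does anything in between. *)
Lemma compact_same_topology : compact [set: X] -> same_topology E.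
Proof.
move=> cX U; split=> [EU|oU x Ux].
  rewrite openE => x /EU[r r0 rU]; rewrite /interior.
  apply/metricType_numDomainType.nbhs_mdistP; exists (r / k) => /=.
    by rewrite divr_gt0.
  move=> y /=; rewrite ltr_pdivlMr// mulrC => xy; apply: rU => /=.
  by rewrite (le_lt_trans (Ek x y))// lte_fin.
have cC : compact (~` U).
  by apply: (subclosed_compact _ cX) => //; exact: open_closedC.
have cI : closed (rd x @` ~` U).
  apply: compact_closed; first exact: Rhausdorff.
  apply: continuous_compact cC; apply: continuous_subspaceT; exact: rd_continuous.
have nI0 : (~` (rd x @` ~` U)) 0.
  move=> [y Uy xy0]; apply: Uy; have [_ Dsep] := Ddist.
  by rewrite -(Dsep x y)// rdE xy0.
have /nbhs_ballP[r /= r0 rI] : nbhs (0 : R) (~` (rd x @` ~` U)).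
  by apply: open_nbhs_nbhs; split => //; exact: closed_openC.
exists r => // y /= xy; apply: contrapT => Uy.
apply: (rI (rd x y)); last by exists y.
rewrite /ball/= sub0r normrN ger0_norm.
  by rewrite -lte_fin -rdE (le_lt_trans (DE x y)).
by rewrite -lee_fin -rdE; case: Ddist => -[/(_ x y)[]].
Qed.

End compact_topology.

Theorem theorem5p15 (R : realType) (K : R) (X : completeMetricType R)
    (m : {measure set (borel X) -> \bar R})
    (H : R -> probability (borel X) R -> probability (borel X) R)
    (hRCD : RCD K m) (hsupp : msupport m = [set: X]) (hH : heat_flow K m H) :
  ((forall x y : X,
      dtilde H 0 x y = (mdist x y)%:E /\ dflow H 0 x y = (mdist x y)%:E) /\
   (forall t : R, 0 < t ->
      pseudo_distance (dtilde H t) /\ pseudo_distance (dflow H t))) /\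
  (forall t : R, 0 < t -> injective_on_P2 (H t) ->
     (distance (dtilde H t) /\ distance (dflow H t)) /\
     (compact [set: X] ->
        same_topology (dtilde H t) /\ same_topology (dflow H t))).
Proof.
have [[sepX _ gaussX] cd _] := hRCD.
have curves : forall (x y : X) (e : R), 0 < e -> exists c : R -> X,
    [/\ c 0 = x, c 1 = y & forall s t, s \in `[0, 1] -> t \in `[0, 1] ->
      mdist (c s) (c t) <= (mdist x y + e) * `|s - t|].
  move=> x y e e0; apply: (almost_shortest_curve _ _ _ e0) => a b d d0.
  exact: (CD_midpoint sepX gaussX hsupp a b cd d0).
have k0 (t : R) : 0 < expR (- K * t) by exact: expR_gt0.
have dist t : 0 <= t -> pseudo_distance (dtilde H t).
  exact: (dtilde_pseudo_distance sepX hH).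
have dle t (x y : X) : 0 <= t -> (dtilde H t x y <= (expR (- K * t) * mdist x y)%:E)%E.
  exact: (dtilde_le sepX hH).
have dle' t (t0 : 0 <= t) (x y : X) : (dtilde H t x y <= (expR (- K * t) * mdist x y)%:E)%E.
  exact: dle.
have flow_dist t : 0 <= t -> pseudo_distance (dflow H t).
  by move=> t0; exact: (intrinsic_pseudo_distance (k0 t) (dist t t0) (dle' t t0) curves).
have flow_ge t (x y : X) : 0 <= t -> (dtilde H t x y <= dflow H t x y)%E.
  by move=> t0; exact: (intrinsic_ge (k0 t) (dist t t0) (dle' t t0)).
have flow_le t (x y : X) : 0 <= t -> (dflow H t x y <= (expR (- K * t) * mdist x y)%:E)%E.
  by move=> t0; exact: (intrinsic_le (k0 t) (dist t t0) (dle' t t0) curves).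
split; first split.
- move=> x y; have d0 := dtilde0 sepX gaussX hsupp hH x y; split=> //.
  apply/eqP; rewrite eq_le -{2}d0 flow_ge// andbT.
  by rewrite (le_trans (flow_le 0 x y (lexx 0)))// mulr0 expR0 mul1r.
- by move=> t /ltW t0; split; [exact: dist|exact: flow_dist].
move=> t t_gt0 inj; have t0 := ltW t_gt0.
have sep := dtilde_separates sepX t_gt0 inj.
have dt : distance (dtilde H t) by split; [exact: dist|exact: sep].
split; first split => //.
  split; first exact: flow_dist.
  move=> x y xy0; apply: sep; apply/eqP; rewrite eq_le -{1}xy0 flow_ge//=.
  by case: (dist t t0) => /(_ x y)[].
move=> cX; split.
- by apply: (compact_same_topology (k0 t) dt) => // x y; exact: dle.
- by apply: (compact_same_topology (k0 t) dt) => // x y; [exact: flow_ge|exact: flow_le].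
Qed.
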